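(* Let $d,n\in\mathbb{Z}_{>0}$, let $q$ be an indeterminate or a non-zero complex number, and let $\mathcal{R}:=\mathbb{C}[q,q^{-1}]$. Let ${\rm Y}_{d,n}^{\mathrm{aff}}(q)$ be the affine Yokonuma--Hecke algebra, with $\mathcal{R}$-basis consisting of the elements $t_1^{a_1}\cdots t_n^{a_n}X_1^{b_1}\cdots X_n^{b_n}g_w$ ($a_1,\ldots,a_n\in\mathbb{Z}/d\mathbb{Z}$, $b_1,\ldots,b_n\in\mathbb{Z}$, $w\in\mathfrak{S}_n$). Let $\mathcal{H}_{\mathcal{R}}(1,c_s)$ be the pro-$p$-Iwahori--Hecke algebra of $\widetilde{W}=((\mathbb{Z}/d\mathbb{Z})^n\times\mathbb{Z}^n)\rtimes\mathfrak{S}_n$ over $\mathcal{R}$, with parameters $q_s=1$ for all $s\in\widetilde{S}^{\mathrm{aff}}$ and $c_{ts_i}=(q-q^{-1})\,t\,e_i$ for all $i=0,1,\ldots,n-1$ and $t\in(\mathbb{Z}/d\mathbb{Z})^n$, with its Bernstein basis $(E(w))_{w\in\widetilde{W}}$. Then the $\mathcal{R}$-linear map $\varphi:{\rm Y}_{d,n}^{\mathrm{aff}}(q)\to\mathcal{H}_{\mathcal{R}}(1,c_s)$ defined by $$\varphi(t_1^{a_1}\cdots t_n^{a_n}\,X_1^{b_1}\cdots X_n^{b_n}\,g_w)=E(t_1^{a_1}\cdots t_n^{a_n}\,(b_1,\ldots,b_n)\,w)$$ for all $a_1,\ldots,a_n\in\mathbb{Z}/d\mathbb{Z}$, $b_1,\ldots,b_n\in\mathbb{Z}$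 and $w\in\mathfrak{S}_n$, is an isomorphism of $\mathcal{R}$-algebras.
   Context: **The affine Yokonuma--Hecke algebra.** Let $s_i$ denote the transposition $(i,i+1)$ in the symmetric group $\mathfrak{S}_n$. ${\rm Y}_{d,n}^{\mathrm{aff}}(q)$ is the associative $\mathcal{R}$-algebra generated by $t_1,\ldots,t_n,g_1,\ldots,g_{n-1},X_1,X_1^{-1}$ (where $X_1^{-1}$ is the inverse of $X_1$) subject to the relations: - $g_ig_j=g_jg_i$ for $i,j=1,\ldots,n-1$ with $|i-j|>1$; - $g_ig_{i+1}g_i=g_{i+1}g_ig_{i+1}$ for $i=1,\ldots,n-2$; - $t_it_j=t_jt_i$ for $i,j=1,\ldots,n$; - $g_it_j=t_{s_i(j)}g_i$ for $i=1,\ldots,n-1$, $j=1,\ldots,n$; - $t_j^d=1$ for $j=1,\ldots,n$; - $X_1g_1X_1g_1=g_1X_1g_1X_1$; - $X_1g_i=g_iX_1$ for $i=2,\ldots,n-1$; - $X_1t_j=t_jX_1$ for $j=1,\ldots,n$; - $g_i^2=1+(q-q^{-1})e_ig_i$ for $i=1,\ldots,n-1$, where $e_i:=\frac1d\sum_{k=0}^{d-1}t_i^kt_{i+1}^{d-k}$. (When $n=1$ there are no generators $g_i$ and the relations involving them are absent.) Define inductively $X_{i+1}:=g_iX_ig_i$ for $i=1,\ldots,n-1$; the elements $t_1,\ldots,t_n,X_1^{\pm1},\ldots,X_n^{\pm1}$ commute with each other. For $w\in\mathfrak{S}_n$ with reduced expression $w=s_{i_1}\cdots s_{i_r}$, put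 $g_w:=g_{i_1}\cdots g_{i_r}$, which does not depend on the reduced expression. It is a known theorem that the elements $t_1^{a_1}\cdots t_n^{a_n}X_1^{b_1}\cdots X_n^{b_n}g_w$, with $a_j\in\mathbb{Z}/d\mathbb{Z}$, $b_j\in\mathbb{Z}$, $w\in\mathfrak{S}_n$, form an $\mathcal{R}$-basis of ${\rm Y}_{d,n}^{\mathrm{aff}}(q)$. **The group $\widetilde{W}$.** Let $\Lambda=\mathbb{Z}^n$, with group law written multiplicatively ($\lambda\lambda'=(\lambda_1+\lambda'_1,\ldots,\lambda_n+\lambda'_n)$), and let $\lambda\circ\lambda'=\sum_j\lambda_j\lambda'_j$ be the dot product. Let $\varepsilon_i=(0,\ldots,0,1,-1,0,\ldots,0)\in\Lambda$, with $1$ in position $i$ and $-1$ in position $i+1$, for $i=1,\ldots,n-1$. Permutations are composed as functions. $\mathfrak{S}_n$ acts on $\Lambda$ by permuting coordinates: $\sigma(\lambda):=\sigma\lambda\sigma^{-1}=(\lambda_{\sigma^{-1}(1)},\ldots,\lambda_{\sigma^{-1}(n)})$. Let $W=\Lambda\rtimes\mathfrak{S}_n$ and $S=\{s_1,\ldots,s_{n-1}\}$. Let $\gamma=s_{n-1}s_{n-2}\cdots s_2s_1\in\mathfrak{S}_n$, $h=(0,\ldots,0,1)\,\gamma\in W$, $s_0:=hs_1h^{-1}\in W$ and $S^{\mathrm{aff}}=S\cup\{s_0\}$; explicitly $s_0=(-1,0,\ldots,0,1)\,\sigma_0$ with $\sigma_0$ the transposition $(1,n)$. (For $n=1$, $S$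 and $S^{\mathrm{aff}}$ are empty.) The subgroup $W^{\mathrm{aff}}$ of $W$ generated by $S^{\mathrm{aff}}$ is the affine Weyl group of type $A$, a Coxeter group with length function $\ell$, and $W=\langle h\rangle\rtimes W^{\mathrm{aff}}$; $\ell$ is extended to $W$ by $\ell(h^kw)=\ell(w)$ for $w\in W^{\mathrm{aff}}$, $k\in\mathbb{Z}$. Let $\mathcal{T}=(\mathbb{Z}/d\mathbb{Z})^n=\langle t_1,\ldots,t_n\mid t_j^d=1,\ t_it_j=t_jt_i\rangle$, on which $\mathfrak{S}_n$ acts by $\sigma(t_j)=\sigma t_j\sigma^{-1}=t_{\sigma(j)}$. Let $\widetilde{W}=(\mathcal{T}\times\Lambda)\rtimes\mathfrak{S}_n$; its elements are written $t\,\lambda\,\sigma$ with $t\in\mathcal{T}$, $\lambda\in\Lambda$, $\sigma\in\mathfrak{S}_n$. Put $\widetilde{\Lambda}=\mathcal{T}\times\Lambda$, $\widetilde{\mathfrak{S}}_n=\mathcal{T}\rtimes\mathfrak{S}_n$, $\widetilde{S}=\{ts\mid s\in S,\ t\in\mathcal{T}\}$ and $\widetilde{S}^{\mathrm{aff}}=\{ts\mid s\in S^{\mathrm{aff}},\ t\in\mathcal{T}\}$. The length is extended to $\widetilde{W}$ by $\ell(tw)=\ell(w)$ for $w\in W$, $t\in\mathcal{T}$. For $s=ts_i\in\widetilde{S}$ and $\nu\in\widetilde{\Lambda}$, $s(\nu)=s\nu s^{-1}$. **The algebra $\mathcal{H}_{\mathcal{R}}(1,c_s)$.** In $\mathcal{R}[\mathcal{T}]$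 let $e_i=\frac1d\sum_{k=0}^{d-1}t_i^kt_{i+1}^{d-k}$ for $i=1,\ldots,n-1$ and $e_0=e_{1,n}=\frac1d\sum_{k=0}^{d-1}t_1^kt_n^{d-k}$. Put $c_{ts_i}=(q-q^{-1})\,t\,e_i\in\mathcal{R}[\mathcal{T}]$ for $i=0,\ldots,n-1$ and $t\in\mathcal{T}$. The pro-$p$-Iwahori--Hecke algebra $\mathcal{H}_{\mathcal{R}}(1,c_s)$ of $\widetilde{W}$ is the free $\mathcal{R}$-module with basis $(T_w)_{w\in\widetilde{W}}$ and the unique $\mathcal{R}$-algebra structure such that $T_wT_{w'}=T_{ww'}$ if $\ell(w)+\ell(w')=\ell(ww')$, and $T_s^2=s^2+c_sT_s$ for $s\in\widetilde{S}^{\mathrm{aff}}$ (here $t\in\mathcal{T}$ is identified with $T_t$; note $s^2\in\mathcal{T}$). By a theorem of Vignéras, this algebra is isomorphic to the free $\mathcal{R}$-module with basis $(E(w))_{w\in\widetilde{W}}$ endowed with the unique $\mathcal{R}$-algebra structure satisfying the following relations (with $E(t)=t$ for $t\in\mathcal{T}$, and $E(s)=T_s$ for $s\in\widetilde{S}$); it is in this form, with the Bernstein basis $(E(w))$, that $\mathcal{H}_{\mathcal{R}}(1,c_s)$ is used: - $E(w)E(w')=E(ww')$ for $w,w'\in\widetilde{\mathfrak{S}}_n$ with $\ell(w)+\ell(w')=\ell(ww')$; - $E(s)^2=s^2+c_sE(s)$ for $s\in\widetilde{S}$; - $E(\nu)E(w)=E(\nu w)$ for $\nu\in\widetilde{\Lambda}$,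 $w\in\widetilde{W}$; - for $s=ts_i\in\widetilde{S}$ ($t\in\mathcal{T}$, $i=1,\ldots,n-1$) and $\nu=\tau\lambda\in\widetilde{\Lambda}$ ($\tau\in\mathcal{T}$, $\lambda\in\Lambda$): $E(s(\nu))E(s)-E(s)E(\nu)$ equals $0$ if $s_i(\lambda)=\lambda$, and equals $\epsilon_i(\lambda)\,c_s\sum_{k=0}^{|\varepsilon_i\circ\lambda|-1}E(\tau\mu_i(k,\lambda))$ if $s_i(\lambda)\neq\lambda$, where $\epsilon_i(\lambda)=\mathrm{sign}(\varepsilon_i\circ\lambda)\in\{1,-1\}$, and $\mu_i(k,\lambda)=\lambda\,\varepsilon_i^k$ if $\epsilon_i(\lambda)=-1$, $\mu_i(k,\lambda)=s_i(\lambda)\,\varepsilon_i^k$ if $\epsilon_i(\lambda)=1$. *)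

(* Defs.v *)
From HB Require Import structures.
From mathcomp Require Import all_boot all_order all_fingroup all_algebra.
From mathcomp Require Import finmap boolp classical_sets reals complex monalg.

Set Implicit Arguments.
Unset Strict Implicit.
Unset Printing Implicit Defensive.

Import Order.TTheory GRing.Theory Num.Theory.

Local Open Scope ring_scope.
Local Open Scope quotient_scope.

(* Throughout, d = d'.+1 and n = n'.+1, so that Z/dZ is the additive group    *)
(* 'I_d'.+1 ('Z_d would be Z/2Z for d = 1).  Indices are 0-based: the index   *)
(* j = 1..n is an element of 'I_n'.+1, and i = 1..n-1 an element of 'I_n'.    *)

Definition is_basis (R : pzRingType) (M : lmodType R) (I : eqType)
    (b : I -> M) : Prop :=
  (forall x, exists (s : seq I) (c : I -> R), x = \sum_(i <- s) c i *: b i) /\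
  (forall (s : seq I) (c : I -> R), uniq s ->
     \sum_(i <- s) c i *: b i = 0 -> {in s, forall i, c i = 0}).

Section Laurent.
Variable F : fieldType.

(* F[X, X^-1], as the subring of F(X) of the fractions p / X^m. *)
Definition is_laurent : {pred {fraction {poly F}}} := fun x =>
  `[< exists (p : {poly F}) (m : nat), x * tofrac 'X ^+ m = tofrac p >].

Record laurent := Laurent { laurent_val :> {fraction {poly F}};
                            _ : laurent_val \in is_laurent }.
HB.instance Definition _ := [isSub for laurent_val].
HB.instance Definition _ := [Choice of laurent by <:].

Lemma is_laurent_subring : subring_closed is_laurent.
Proof.
split.
- by apply/asboolP; exists 1, 0%N; rewrite expr0 mulr1 rmorph1.
- move=> x y /asboolP[p [m xE]] /asboolP[r [k yE]]; apply/asboolP.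
  exists (p * 'X ^+ k - r * 'X ^+ m), (m + k)%N.
  rewrite rmorphB !rmorphM !rmorphXn /= -xE -yE -!mulrA -!exprD (addnC k).
  by rewrite mulrBl.
- move=> x y /asboolP[p [m xE]] /asboolP[r [k yE]]; apply/asboolP.
  by exists (p * r), (m + k)%N; rewrite rmorphM /= -xE -yE exprD mulrACA.
Qed.

HB.instance Definition _ :=
  GRing.SubChoice_isSubComNzRing.Build _ is_laurent laurent is_laurent_subring.

Definition laurent_unit (x : laurent) :=
  (val x != 0) && ((val x)^-1 \in is_laurent).
Definition laurent_inv (x : laurent) : laurent := insubd x (val x)^-1.

Lemma laurent_mulV : {in laurent_unit, left_inverse 1 laurent_inv *%R}.
Proof.
move=> x /andP[x0 xV]; apply: val_inj; rewrite rmorphM rmorph1 /=.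
by rewrite /laurent_inv insubdK // mulVf.
Qed.

Lemma laurent_unitP (x y : laurent) : y * x = 1 -> laurent_unit x.
Proof.
move=> yx1; have {}yx1 : val y * val x = 1 by rewrite -rmorphM yx1 rmorph1.
have x0 : val x != 0.
  by apply/eqP => x0; move/eqP: yx1; rewrite x0 mulr0 eq_sym oner_eq0.
rewrite /laurent_unit x0 /=.
have -> : (val x)^-1 = val y by apply: (mulIf x0); rewrite mulVf.
exact: valP.
Qed.

Lemma laurent_invN : {in [predC laurent_unit], laurent_inv =1 id}.
Proof.
move=> x; rewrite inE negb_and negbK => /orP[/eqP x0|xV].
  by rewrite /laurent_inv x0 invr0 -x0 valKd.
by rewrite /laurent_inv /insubd insubN.
Qed.

HB.instance Definition _ := GRing.ComNzRing_hasMulInverse.Build laurent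
  laurent_mulV laurent_unitP laurent_invN.

Lemma laurentX_subproof : tofrac 'X \in is_laurent.
Proof. by apply/asboolP; exists 'X, 0%N; rewrite expr0 mulr1. Qed.
Definition laurentX : laurent := Laurent laurentX_subproof.

Lemma laurentX_unit : laurentX \is a GRing.unit.
Proof.
have X0 : tofrac ('X : {poly F}) != 0 by rewrite tofrac_eq0 polyX_eq0.
rewrite unfold_in /= /laurent_unit X0 /=; apply/asboolP; exists 1, 1%N.
by rewrite expr1 mulVf ?rmorph1.
Qed.

End Laurent.

Variant qparam (K : realType) :=
  | Indeterminate
  | NonzeroComplex (z : K[i]%C) of z != 0.

(* R = C[q, q^-1]; this is C itself when q is a nonzero complex number. *)
Definition base (K : realType) (b : qparam K) : comUnitRingType :=
  match b with
  | Indeterminate => laurent (K[i]%C)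
  | NonzeroComplex _ _ => K[i]%C
  end.

Definition qof (K : realType) (b : qparam K) : base b :=
  match b with
  | Indeterminate => laurentX (K[i]%C)
  | NonzeroComplex z _ => z
  end.

Lemma qof_unit (K : realType) (b : qparam K) : qof b \is a GRing.unit.
Proof. by case: b => [|z z0] /=; rewrite ?laurentX_unit ?unitfE. Qed.

Lemma base_natr_unit (K : realType) (b : qparam K) (m : nat) :
  (m.+1)%:R \is a @GRing.unit (base b).
Proof.
case: b => [|z z0] /=; last by rewrite unitfE pnatr_eq0.
have m0 : (m.+1)%:R != 0 :> K[i]%C by rewrite pnatr_eq0.
pose c := tofrac ((m.+1%:R^-1 : K[i]%C)%:P).
have cm : c * (m.+1)%:R = 1.
  by rewrite -(rmorph_nat (@tofrac _)) -rmorphM -(rmorph_nat (@polyC _))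
             -polyCM mulVf // !rmorph1.
have cL : c \in @is_laurent (K[i]%C).
  by apply/asboolP; exists (m.+1%:R^-1 : K[i]%C)%:P, 0%N; rewrite expr0 mulr1.
apply/unitrP; exists (Laurent cL); rewrite mulrC.
by split; apply: val_inj; rewrite rmorphM rmorph1 rmorph_nat /= mulrC.
Qed.

(* The free algebra R<G>, the monoid algebra of the free monoid on G. *)
Definition free_alg (R : comNzRingType) (G : choiceType) : Type :=
  {malg R[{fmonom G}]}.
HB.instance Definition _ R G := GRing.Lalgebra.on (free_alg R G).

Definition free_gen (R : comNzRingType) (G : choiceType) (x : G) :
  free_alg R G := << fmu x >>.

Section Presentation.
Variables (R : comNzRingType) (G : choiceType).
Local Notation free_alg := (free_alg R G).

Lemma free_scalerAr (c : R) (u v : free_alg) : c *: (u * v) = u * (c *: v).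
Proof.
suff comm (w : {malg R[{fmonom G}]}) : c *: w = w * malgC c.
  by rewrite [LHS]comm [in RHS]comm mulrA.
apply/malgP => k; rewrite mcoeffZ.
rewrite (mcoeffMrw k (fsubset_refl _) (msuppC_le c)).
rewrite big_seq_fset1 mcoeffC eqxx mulr1n.
rewrite (eq_bigr (fun l => c * (w@_l *+ (l == k)))); last first.
  by move=> l _; rewrite mulm1 (mulrC _ c) mulrnAr.
rewrite -mulr_sumr; congr (_ * _).
have [kw|kw] := boolP (k \in msupp w).
  rewrite (big_fsetD1 k) //= eqxx big_seq big1 ?addr0 // => l.
  by rewrite !inE => /andP[/negPf ->].
rewrite mcoeff_outdom // big_seq big1 // => l lw.
by case: eqP => // lk; rewrite lk (negPf kw) in lw.
Qed.

Variable rels : free_alg -> free_alg -> Prop.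

(* The two-sided ideal generated by the differences x - y for x = y a         *)
(* relation.                                                                  *)
Inductive rel_ideal : free_alg -> Prop :=
  | RelIdeal_rel x y of rels x y : rel_ideal (x - y)
  | RelIdeal0 : rel_ideal 0
  | RelIdealD x y of rel_ideal x & rel_ideal y : rel_ideal (x + y)
  | RelIdealM a x c of rel_ideal x : rel_ideal (a * x * c).

Definition rel_equiv : rel free_alg := fun x y => `[< rel_ideal (x - y) >].

Lemma rel_idealN x : rel_ideal x -> rel_ideal (- x).
Proof. by move=> /(RelIdealM (-1) 1); rewrite mulN1r mulr1. Qed.

Lemma rel_equivP x y : reflect (rel_ideal (x - y)) (rel_equiv x y).
Proof. exact: asboolP. Qed.

Lemma rel_equiv_refl : reflexive rel_equiv.
Proof. by move=> x; apply/rel_equivP; rewrite subrr; apply: RelIdeal0. Qed.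

Lemma rel_equiv_sym : symmetric rel_equiv.
Proof.
by move=> x y; apply/rel_equivP/rel_equivP => /rel_idealN; rewrite opprB.
Qed.

Lemma rel_equiv_trans : transitive rel_equiv.
Proof.
move=> y x z /rel_equivP xy /rel_equivP yz; apply/rel_equivP.
by rewrite -(subrK y x) -addrA; apply: RelIdealD.
Qed.

Canonical rel_equiv_equiv :=
  EquivRel rel_equiv rel_equiv_refl rel_equiv_sym rel_equiv_trans.

Definition pres_alg := {eq_quot rel_equiv}.
HB.instance Definition _ := Choice.on pres_alg.
HB.instance Definition _ : EqQuotient _ rel_equiv pres_alg :=
  EqQuotient.on pres_alg.

Definition pres_gen (x : G) : pres_alg := \pi_pres_alg (free_gen R x).

Definition pres_add := lift_op2 pres_alg +%R.
Definition pres_opp := lift_op1 pres_alg -%R.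
Definition pres_mul := lift_op2 pres_alg *%R.
Definition pres_scale (c : R) := lift_op1 pres_alg ( *:%R c).
Definition pres0 := lift_cst pres_alg 0.
Definition pres1 := lift_cst pres_alg 1.

Lemma pi_pres_add : {morph \pi_pres_alg : x y / x + y >-> pres_add x y}.
Proof.
move=> x y; unlock pres_add; apply/eqmodP/rel_equivP.
rewrite opprD addrACA.
by apply: RelIdealD; apply/rel_equivP/eqmodP; rewrite /= reprK.
Qed.
Canonical pi_pres_add_morph := PiMorph2 pi_pres_add.

Lemma pi_pres_opp : {morph \pi_pres_alg : x / - x >-> pres_opp x}.
Proof.
move=> x; unlock pres_opp; apply/eqmodP/rel_equivP.
rewrite -opprD; apply: rel_idealN.
by apply/rel_equivP/eqmodP; rewrite /= reprK.
Qed.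
Canonical pi_pres_opp_morph := PiMorph1 pi_pres_opp.

Lemma pi_pres_mul : {morph \pi_pres_alg : x y / x * y >-> pres_mul x y}.
Proof.
move=> x y; unlock pres_mul; apply/eqmodP/rel_equivP.
set x' := generic_quotient.repr _; set y' := generic_quotient.repr _.
have xx : rel_ideal (x - x') by apply/rel_equivP/eqmodP; rewrite /= reprK.
have yy : rel_ideal (y - y') by apply/rel_equivP/eqmodP; rewrite /= reprK.
have -> : x * y - x' * y' = 1 * (x - x') * y + x' * (y - y') * 1.
  by rewrite mul1r mulr1 mulrBl mulrBr addrA subrK.
by apply: RelIdealD; apply: RelIdealM.
Qed.
Canonical pi_pres_mul_morph := PiMorph2 pi_pres_mul.

Lemma pi_pres_scale c : {morph \pi_pres_alg : x / c *: x >-> pres_scale c x}.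
Proof.
move=> x; unlock pres_scale; apply/eqmodP/rel_equivP.
set x' := generic_quotient.repr _.
have xx : rel_ideal (x - x') by apply/rel_equivP/eqmodP; rewrite /= reprK.
have -> : c *: x - c *: x' = (c *: 1) * (x - x') * 1.
  by rewrite mulr1 -scalerAl mul1r scalerBr.
exact: RelIdealM.
Qed.
Canonical pi_pres_scale_morph c := PiMorph1 (pi_pres_scale c).
Canonical pi_pres0_morph := PiConst pres0.
Canonical pi_pres1_morph := PiConst pres1.

Lemma pres_addA : associative pres_add.
Proof. by elim/quotW=> x; elim/quotW=> y; elim/quotW=> z; rewrite !piE addrA. Qed.
Lemma pres_addC : commutative pres_add.
Proof. by elim/quotW=> x; elim/quotW=> y; rewrite !piE addrC. Qed.
Lemma pres_add0 : left_id pres0 pres_add.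
Proof. by elim/quotW=> x; rewrite !piE add0r. Qed.
Lemma pres_addN : left_inverse pres0 pres_opp pres_add.
Proof. by elim/quotW=> x; rewrite !piE addNr. Qed.

HB.instance Definition _ :=
  GRing.isZmodule.Build pres_alg pres_addA pres_addC pres_add0 pres_addN.

Lemma pres_mulA : associative pres_mul.
Proof. by elim/quotW=> x; elim/quotW=> y; elim/quotW=> z; rewrite !piE mulrA. Qed.
Lemma pres_mul1l : left_id pres1 pres_mul.
Proof. by elim/quotW=> x; rewrite !piE mul1r. Qed.
Lemma pres_mul1r : right_id pres1 pres_mul.
Proof. by elim/quotW=> x; rewrite !piE mulr1. Qed.
Lemma pres_mulDl : left_distributive pres_mul pres_add.
Proof. by elim/quotW=> x; elim/quotW=> y; elim/quotW=> z; rewrite !piE mulrDl. Qed.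
Lemma pres_mulDr : right_distributive pres_mul pres_add.
Proof. by elim/quotW=> x; elim/quotW=> y; elim/quotW=> z; rewrite !piE mulrDr. Qed.

HB.instance Definition _ := GRing.Zmodule_isPzRing.Build pres_alg
  pres_mulA pres_mul1l pres_mul1r pres_mulDl pres_mulDr.

Lemma pres_scaleA a c x : pres_scale a (pres_scale c x) = pres_scale (a * c) x.
Proof. by elim/quotW: x => x; rewrite !piE scalerA. Qed.
Lemma pres_scale1 : left_id 1 pres_scale.
Proof. by elim/quotW=> x; rewrite !piE scale1r. Qed.
Lemma pres_scaleDr : right_distributive pres_scale pres_add.
Proof. by move=> c; elim/quotW=> x; elim/quotW=> y; rewrite !piE scalerDr. Qed.
Lemma pres_scaleDl x : {morph pres_scale^~ x : a c / a + c >-> pres_add a c}.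
Proof. by move=> a c; elim/quotW: x => x; rewrite !piE scalerDl. Qed.

HB.instance Definition _ := GRing.Zmodule_isLmodule.Build R pres_alg
  pres_scaleA pres_scale1 pres_scaleDr pres_scaleDl.

Lemma pres_scaleAl (c : R) (x y : pres_alg) : c *: (x * y) = (c *: x) * y.
Proof.
elim/quotW: x => x; elim/quotW: y => y.
rewrite -[LHS]/(pres_scale c (pres_mul _ _)).
by rewrite -[RHS]/(pres_mul (pres_scale c _) _) !piE scalerAl.
Qed.

Lemma pres_scaleAr (c : R) (x y : pres_alg) : c *: (x * y) = x * (c *: y).
Proof.
elim/quotW: x => x; elim/quotW: y => y.
rewrite -[LHS]/(pres_scale c (pres_mul _ _)).
by rewrite -[RHS]/(pres_mul _ (pres_scale c _)) !piE free_scalerAr.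
Qed.

Lemma pres_neq0P : ~ rel_ideal 1 -> (1 : pres_alg) != 0.
Proof.
move=> h; apply/eqP => e; apply: h; rewrite -[1]subr0; apply/rel_equivP.
by apply/eqmodP; move: e; rewrite -[LHS]/pres1 -[RHS]/pres0 !piE.
Qed.

End Presentation.

Section Combinatorics.
Variable n' : nat.
Local Notation n := n'.+1.

Definition posl (i : 'I_n') : 'I_n := widen_ord (leqnSn n') i.
Definition posr (i : 'I_n') : 'I_n := lift ord0 i.

Definition sref (i : 'I_n') : 'S_n := tperm (posl i) (posr i).

(* Composition as functions; the product of 'S_n composes left to right. *)
Definition pcomp (u v : 'S_n) : 'S_n := (v * u)%g.

Definition word_perm (s : seq 'I_n') : 'S_n :=
  foldr (fun i w => pcomp (sref i) w) 1%g s.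

Definition reduced (w : 'S_n) (s : seq 'I_n') : Prop :=
  word_perm s = w /\ forall s', word_perm s' = w -> (size s <= size s')%N.

Definition reduced_word (w : 'S_n) : seq 'I_n' :=
  xget [::] [set s | reduced w s]%classic.

(* sigma(v) = (v_{sigma^-1(1)}, ..., v_{sigma^-1(n)}) *)
Definition pact (V : Type) (w : 'S_n) (v : {ffun 'I_n -> V}) :
  {ffun 'I_n -> V} := [ffun j => v ((w^-1)%g j)].

Definition dotZ (x y : {ffun 'I_n -> int}) : int := \sum_j x j * y j.

Definition varepsilon (i : 'I_n') : {ffun 'I_n -> int} :=
  [ffun j => (j == posl i)%:R - (j == posr i)%:R].

End Combinatorics.

Variant Ygen (n' : nat) :=
  | Gen_t of 'I_n'.+1
  | Gen_g of 'I_n'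
  | Gen_X
  | Gen_Xinv.
HB.instance Definition _ n' := gen_eqMixin (Ygen n').
HB.instance Definition _ n' := gen_choiceMixin (Ygen n').
Definition Ygens (n' : nat) : choiceType := Ygen n'.

(* (1/d) * sum_(0 <= k < d) x^k y^(d-k) *)
Definition idem (R : comUnitRingType) (A : lalgType R) (d' : nat) (x y : A) : A :=
  (d'.+1%:R : R)^-1 *: \sum_(0 <= k < d'.+1) x ^+ k * y ^+ (d'.+1 - k).

Section YokonumaHecke.
Variables (K : realType) (b : qparam K) (d' n' : nat).
Local Notation d := d'.+1.
Local Notation n := n'.+1.
Local Notation R := (base b).
Local Notation q := (qof b).

Local Notation F := (free_alg R (Ygens n')).
Let t (j : 'I_n) : F := free_gen R (Gen_t j : Ygens n').
Let g (i : 'I_n') : F := free_gen R (Gen_g i : Ygens n').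
Let X : F := free_gen R (Gen_X n' : Ygens n').
Let Xinv : F := free_gen R (Gen_Xinv n' : Ygens n').
Let e (i : 'I_n') : F := idem d' (t (posl i)) (t (posr i)).

Inductive Yrel : F -> F -> Prop :=
  | Yrel_gg (i j : 'I_n') of (i.+1 < j)%N || (j.+1 < i)%N :
      Yrel (g i * g j) (g j * g i)
  | Yrel_braid (i j : 'I_n') of j = i.+1 :> nat :
      Yrel (g i * g j * g i) (g j * g i * g j)
  | Yrel_tt (i j : 'I_n) : Yrel (t i * t j) (t j * t i)
  | Yrel_gt (i : 'I_n') (j : 'I_n) : Yrel (g i * t j) (t (sref i j) * g i)
  | Yrel_td (j : 'I_n) : Yrel (t j ^+ d) 1
  | Yrel_XV : Yrel (X * Xinv) 1
  | Yrel_VX : Yrel (Xinv * X) 1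
  | Yrel_XgXg (i : 'I_n') of i = 0 :> nat :
      Yrel (X * g i * X * g i) (g i * X * g i * X)
  | Yrel_Xg (i : 'I_n') of (0 < i)%N : Yrel (X * g i) (g i * X)
  | Yrel_Xt (j : 'I_n) : Yrel (X * t j) (t j * X)
  | Yrel_quad (i : 'I_n') : Yrel (g i ^+ 2) (1 + (q - q^-1) *: (e i * g i)).

Definition Yaff := pres_alg Yrel.

HB.instance Definition _ := GRing.PzRing.on Yaff.
HB.instance Definition _ := GRing.Lmodule.on Yaff.

(* Y is not the zero ring: t_j, X_1 |-> 1, g_i |-> q is a character. *)
Definition Ychar_gen (x : Ygens n') : R := if x is Gen_g _ then q else 1.
Definition Ychar_mon (m : {fmonom (Ygens n')}) : R :=
  \prod_(x <- (m : seq _)) Ychar_gen x.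

Lemma Ychar_mon_morph : mmorphism Ychar_mon.
Proof.
split=> [x y|]; first by rewrite /Ychar_mon fmM big_cat.
by rewrite /Ychar_mon fm1 big_nil.
Qed.
HB.instance Definition _ := monalg.isMultiplicative.Build
  {fmonom (Ygens n')} R Ychar_mon Ychar_mon_morph.

Lemma Ychar_exists : exists chi : F -> R,
  [/\ {morph chi : x y / x + y}, {morph chi : x y / x * y}, chi 1 = 1,
      (forall c x, chi (c *: x) = c * chi x)
    & (forall x, chi (free_gen R x) = Ychar_gen x)].
Proof.
exists (mmap idfun Ychar_mon); split.
- exact: rmorphD.
- exact: rmorphM.
- exact: rmorph1.
- exact: mmapZ.
- by move=> x; rewrite mmapU mul1r /Ychar_mon fmU big_seq1.
Qed.

Lemma Yaff_nontrivial : (1 : Yaff) != 0.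
Proof.
have [chi [chiD chiM chi1 chiZ chi_gen]] := Ychar_exists.
have chi0 : chi 0 = 0 by apply: (addIr (chi 0)); rewrite -chiD !add0r.
have chiX m x : chi (x ^+ m) = chi x ^+ m.
  by elim: m => [|m IHm]; rewrite ?expr0 ?chi1 // !exprS chiM IHm.
have chi_e i : chi (e i) = 1.
  rewrite /idem chiZ (big_morph _ chiD chi0) (eq_bigr (fun=> 1)) => [|k _].
    by rewrite sumr_const_nat subn0 mulVr // base_natr_unit.
  by rewrite chiM !chiX !chi_gen !expr1n mulr1.
have chi_rel x y : Yrel x y -> chi x = chi y.
  case=> [i j _|i j _|i j|i j|j|||i _|i _|j|i].
  (* [LHS] and [RHS] avoid comparing products in F up to conversion. *)
  - by rewrite [LHS]chiM [RHS]chiM [LHS]mulrC.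
  - by rewrite [LHS]chiM [RHS]chiM [in LHS]chiM [in RHS]chiM !chi_gen.
  - by rewrite [LHS]chiM [RHS]chiM [LHS]mulrC.
  - by rewrite [LHS]chiM [RHS]chiM [LHS]mulrC !chi_gen.
  - by rewrite chiX chi1 chi_gen expr1n.
  - by rewrite chiM chi1 !chi_gen mulr1.
  - by rewrite chiM chi1 !chi_gen mulr1.
  - rewrite [LHS]chiM [RHS]chiM [in LHS]chiM [in RHS]chiM.
    by rewrite [in LHS]chiM [in RHS]chiM !chi_gen !mul1r !mulr1.
  - by rewrite [LHS]chiM [RHS]chiM [LHS]mulrC.
  - by rewrite [LHS]chiM [RHS]chiM [LHS]mulrC.
  rewrite chiX chiD chi1 chiZ chiM chi_e chi_gen /=.
  by rewrite mul1r mulrBl mulVr ?qof_unit // addrC subrK.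
apply: pres_neq0P => I1.
suff chiI x : rel_ideal Yrel x -> chi x = 0.
  by move/eqP: (chiI _ I1); rewrite chi1 oner_eq0.
elim=> {x I1} [x y /chi_rel xy| |x y _ IHx _ IHy|a x c _ IHx].
- by apply: (addIr (chi y)); rewrite -chiD subrK add0r.
- exact: chi0.
- by rewrite chiD IHx IHy addr0.
- by rewrite !chiM IHx mulr0 mul0r.
Qed.

HB.instance Definition _ := GRing.PzSemiRing_isNonZero.Build Yaff Yaff_nontrivial.
HB.instance Definition _ :=
  GRing.Lmodule_isLalgebra.Build R Yaff (@pres_scaleAl _ _ Yrel).
HB.instance Definition _ :=
  GRing.Lalgebra_isAlgebra.Build R Yaff (@pres_scaleAr _ _ Yrel).

(* Inverses, so that the powers of an invertible element make sense. *)
Definition is_Yinv (x : Yaff) : set Yaff := fun y => y * x = 1 /\ x * y = 1.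
Definition Yunit (x : Yaff) := `[< exists y, is_Yinv x y >].
Definition Yinv (x : Yaff) : Yaff := xget x (is_Yinv x).

Lemma YmulV : {in Yunit, left_inverse 1 Yinv *%R}.
Proof. by move=> x /asboolP h; case: (xgetPex x h). Qed.
Lemma YmulrV : {in Yunit, right_inverse 1 Yinv *%R}.
Proof. by move=> x /asboolP h; case: (xgetPex x h). Qed.
Lemma YunitP x y : y * x = 1 /\ x * y = 1 -> Yunit x.
Proof. by move=> h; apply/asboolP; exists y. Qed.
Lemma YinvN : {in [predC Yunit], Yinv =1 id}.
Proof.
by move=> x /negP h; apply: xgetPN => y xy; apply/h/asboolP; exists y.
Qed.
HB.instance Definition _ :=
  GRing.NzRing_hasMulInverse.Build Yaff YmulV YmulrV YunitP YinvN.

Definition Yt (j : 'I_n) : Yaff := pres_gen Yrel (Gen_t j : Ygens n').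
Definition Yg (i : 'I_n') : Yaff := pres_gen Yrel (Gen_g i : Ygens n').
Definition YX1 : Yaff := pres_gen Yrel (Gen_X n' : Ygens n').

(* X_(k+1); the default value 1 is never used for k <= n - 1. *)
Fixpoint YX_nat (k : nat) : Yaff :=
  if k is m.+1 then
    let gm := oapp Yg 1 (insub m) in gm * YX_nat m * gm
  else YX1.
Definition YX (j : 'I_n) : Yaff := YX_nat j.

(* Any reduced word of w gives the same g_w, by the braid relations. *)
Definition Yg_perm (w : 'S_n) : Yaff := \prod_(i <- reduced_word w) Yg i.

(* t_1^a_1 ... t_n^a_n X_1^b_1 ... X_n^b_n g_w *)
Definition Ybasis (a : {ffun 'I_n -> 'I_d}) (l : {ffun 'I_n -> int})
    (w : 'S_n) : Yaff :=
  (\prod_j Yt j ^+ a j) * (\prod_j YX j ^ l j) * Yg_perm w.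

End YokonumaHecke.

Section ExtendedGroup.
Variables d' n' : nat.
Local Notation d := d'.+1.
Local Notation n := n'.+1.

(* The element t lambda sigma. *)
Record Wt := MkWt {
  tor : {ffun 'I_n -> 'I_d};
  lat : {ffun 'I_n -> int};
  prm : 'S_n }.

Definition Wt_tuple (x : Wt) := (tor x, lat x, prm x).
Definition tuple_Wt x := MkWt x.1.1 x.1.2 x.2.
Lemma Wt_tupleK : cancel Wt_tuple tuple_Wt. Proof. by case. Qed.
HB.instance Definition _ := Choice.copy Wt (can_type Wt_tupleK).

Definition Wt_one : Wt := MkWt 0 0 1%g.
Definition Wt_mul (x y : Wt) : Wt :=
  MkWt (tor x + pact (prm x) (tor y)) (lat x + pact (prm x) (lat y))
       (pcomp (prm x) (prm y)).
Definition Wt_inv (x : Wt) : Wt :=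
  let s := (prm x)^-1%g in MkWt (- pact s (tor x)) (- pact s (lat x)) s.

Lemma pact_pcomp V (u v : 'S_n) (x : {ffun 'I_n -> V}) :
  pact (pcomp u v) x = pact u (pact v x).
Proof. by apply/ffunP => j; rewrite !ffunE invMg permM. Qed.
Lemma pact1 V (x : {ffun 'I_n -> V}) : pact 1%g x = x.
Proof. by apply/ffunP => j; rewrite ffunE invg1 perm1. Qed.
Lemma pactD (V : zmodType) (u : 'S_n) (x y : {ffun 'I_n -> V}) :
  pact u (x + y) = pact u x + pact u y.
Proof. by apply/ffunP => j; rewrite !ffunE. Qed.
Lemma pactN (V : zmodType) (u : 'S_n) (x : {ffun 'I_n -> V}) :
  pact u (- x) = - pact u x.
Proof. by apply/ffunP => j; rewrite !ffunE. Qed.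
Lemma pact0 (V : zmodType) (u : 'S_n) : pact u (0 : {ffun 'I_n -> V}) = 0.
Proof. by apply/ffunP => j; rewrite !ffunE. Qed.

Lemma Wt_mulA : associative Wt_mul.
Proof.
by move=> x y z; rewrite /Wt_mul /= !pactD !addrA !pact_pcomp /pcomp mulgA.
Qed.
Lemma Wt_mul1 : left_id Wt_one Wt_mul.
Proof. by case=> *; rewrite /Wt_mul /= !pact1 !add0r /pcomp mulg1. Qed.
Lemma Wt_mulr1 : right_id Wt_one Wt_mul.
Proof. by case=> *; rewrite /Wt_mul /= !pact0 !addr0 /pcomp mul1g. Qed.
Lemma Wt_mulV : left_inverse Wt_one Wt_inv Wt_mul.
Proof. by case=> *; rewrite /Wt_mul /= !addNr /pcomp mulgV. Qed.
Lemma Wt_mulrV : right_inverse Wt_one Wt_inv Wt_mul.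
Proof.
by case=> *; rewrite /Wt_mul /= !pactN -!pact_pcomp /pcomp !mulVg !pact1 !subrr.
Qed.

HB.instance Definition _ := isGroup.Build Wt
  Wt_mulA Wt_mul1 Wt_mulr1 Wt_mulV Wt_mulrV.

Definition Wtor (a : {ffun 'I_n -> 'I_d}) : Wt := MkWt a 0 1%g.
Definition Wlat (l : {ffun 'I_n -> int}) : Wt := MkWt 0 l 1%g.
Definition Wprm (w : 'S_n) : Wt := MkWt 0 0 w.

(* The generator t_j of T; inZp is used since 'I_1 has no element 1. *)
Definition tgen (j : 'I_n) : Wt := Wtor [ffun k => inZp (k == j)].

(* h = (0, ..., 0, 1) gamma with gamma = s_(n-1) ... s_2 s_1 *)
Definition hW : Wt :=
  (Wlat [ffun j => (j == ord_max)%:R]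
   * \prod_(i <- rev (enum 'I_n')) Wprm (sref i))%g.

(* s_0 = h s_1 h^-1, where s_1 = (1, 2); only meaningful for n >= 2. *)
Definition s0W : Wt := (hW * Wprm (tperm ord0 (inord 1)) * hW^-1)%g.

(* S^aff, as a subset of W, itself seen inside W~. *)
Definition Saff (x : Wt) : Prop :=
  (exists i : 'I_n', x = Wprm (sref i)) \/ ((0 < n')%N /\ x = s0W).

Definition Saff_word (w : Wt) (s : seq Wt) : Prop :=
  {in s, forall x, Saff x} /\ (\prod_(x <- s) x)%g = w.

(* l is the Coxeter length of w in W^aff = <S^aff>. *)
Definition is_aff_length (w : Wt) (l : nat) : Prop :=
  (exists2 s, Saff_word w s & size s = l) /\
  (forall s, Saff_word w s -> (l <= size s)%N).

Definition expgz (x : Wt) (k : int) : Wt :=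
  match k with Posz m => x ^+ m | Negz m => x ^- m.+1 end%g.

(* l(t h^k w) = l(w) for t in T, k in Z and w in W^aff *)
Definition is_length (w : Wt) (l : nat) : Prop :=
  exists (a : {ffun 'I_n -> 'I_d}) (k : int) (w' : Wt),
    w = (Wtor a * expgz hW k * w')%g /\ is_aff_length w' l.

Definition ell (w : Wt) : nat := xget 0%N [set l | is_length w l]%classic.

End ExtendedGroup.

Section ProPIwahoriHecke.
Variables (K : realType) (b : qparam K) (d' n' : nat).
Local Notation d := d'.+1.
Local Notation n := n'.+1.
Local Notation R := (base b).
Local Notation q := (qof b).
Local Notation W := (Wt d' n').
Variable H : algType R.

(* The image in H of (q - q^-1) t e_{i,j}, an element of R[T], under the      *)
(* identification of t in T with B t, where                                   *)
(* e_{i,j} = (1/d) * sum_(0 <= k < d) t_i^k t_j^(d-k).                        *)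
Definition cpar (B : W -> H) (a : {ffun 'I_n -> 'I_d}) (i j : 'I_n) : H :=
  (q - q^-1) *: ((d%:R : R)^-1 *:
    \sum_(0 <= k < d)
      B (Wtor a * (tgen d' i ^+ k * tgen d' j ^+ (d - k)))%g).

(* H is H_R(1, c_s) with its basis (T_w): the braid relations, and the        *)
(* quadratic relations for t s_i and for t s_0.                               *)
Record is_Iwahori_Matsumoto (T : W -> H) : Prop := {
  IM_basis : is_basis T;
  IM_braid : forall w w' : W, (ell w + ell w')%N = ell (w * w')%g ->
    T w * T w' = T (w * w')%g;
  IM_quad : forall (a : {ffun 'I_n -> 'I_d}) (i : 'I_n'),
    let s := (Wtor a * Wprm d' (sref i))%g in
    T s ^+ 2 = T (s ^+ 2)%g + cpar T a (posl i) (posr i) * T s;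
  IM_quad0 : forall a : {ffun 'I_n -> 'I_d}, (0 < n')%N ->
    let s := (Wtor a * s0W d' n')%g in
    T s ^+ 2 = T (s ^+ 2)%g + cpar T a ord0 ord_max * T s }.

Definition eps_sign (i : 'I_n') (l : {ffun 'I_n -> int}) : int :=
  Num.sg (dotZ (varepsilon i) l).
Definition mu (i : 'I_n') (k : nat) (l : {ffun 'I_n -> int}) :
    {ffun 'I_n -> int} :=
  (if eps_sign i l == -1 then l else pact (sref i) l) + varepsilon i *+ k.

(* (E(w)) is a Bernstein basis of H, normalised by E(t) = t and E(s) = T_s.    *)
Record is_Bernstein (T E : W -> H) : Prop := {
  B_basis : is_basis E;
  B_tor : forall a : {ffun 'I_n -> 'I_d}, E (Wtor a) = T (Wtor a);
  B_ref : forall (a : {ffun 'I_n -> 'I_d}) (i : 'I_n'),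
    let s := (Wtor a * Wprm d' (sref i))%g in E s = T s;
  B_braid : forall w w' : W, lat w = 0 -> lat w' = 0 ->
    (ell w + ell w')%N = ell (w * w')%g -> E w * E w' = E (w * w')%g;
  B_quad : forall (a : {ffun 'I_n -> 'I_d}) (i : 'I_n'),
    let s := (Wtor a * Wprm d' (sref i))%g in
    E s ^+ 2 = E (s ^+ 2)%g + cpar E a (posl i) (posr i) * E s;
  B_prod : forall nu w : W, prm nu = 1%g -> E nu * E w = E (nu * w)%g;
  B_rel : forall (a tau : {ffun 'I_n -> 'I_d}) (i : 'I_n')
      (l : {ffun 'I_n -> int}),
    let s := (Wtor a * Wprm d' (sref i))%g in
    let nu := (Wtor tau * Wlat d' l)%g in
    E (s * nu * s^-1)%g * E s - E s * E nu =
      if pact (sref i) l == l then 0 else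
      (eps_sign i l)%:~R *: (cpar E a (posl i) (posr i) *
        \sum_(0 <= k < `|dotZ (varepsilon i) l|%N)
          E (Wtor tau * Wlat d' (mu i k l))%g) }.

End ProPIwahoriHecke.

(* Main.v *)
Require Import Defs.
From HB Require Import structures.
From mathcomp Require Import all_boot all_order all_fingroup all_algebra.
From mathcomp Require Import finmap boolp classical_sets reals complex monalg.
From mathcomp Require Import zify.

(** The map of the theorem is built from the presentation: sending t_j, g_i and
X_1 to E(t_j), E(s_i) and E(delta_1) respects the defining relations, and the
resulting algebra morphism maps the family t^a X^l g_w to the Bernstein basis.
Here delta_i is the vector of the lattice with a single entry 1, in position i.
Such a morphism is onto, and it is injective as soon as that family spans the
affine Yokonuma--Hecke algebra: a relation in the source would give one between
distinct elements of the basis E. The linear independence of the family t^a X^l g_w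
is thus a consequence, and only its spanning property has to be established.

Three ingredients carry the proof.

Lengths. The multiplicativity of E on permutations is conditional on lengths
adding up, for the length of the extended affine group. On a permutation this
length is the number of inversions ([ell_prm]), although words may use the
affine reflection s_0. The reason is geometric: right multiplication by a
generator moves an alcove to an adjacent one, so at most one of the finitely
many hyperplanes x_i = x_j through the origin is crossed at each step. Hence E
is multiplicative along reduced words ([E_word]), which gives the braid
relations and the images of the g_w.

Relations. The Bernstein relation for delta_i, combined with the quadratic
relation, becomes E(s_i) E(delta_i) E(s_i) = E(delta_(i+1)) ([Eg_EX_Eg]). This is
the recursion defining X_(i+1), and the relation between X_1 and g_1 then says that
E(delta_1) and E(delta_2) commute.

Spanning. Let A be the subalgebra generated by the t_j and the X_j, inverses
included. The X_j commute ([YX_comm]), so A is spanned by the t^a X^l, and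
g_i A is contained in A g_i + A ([g_TX]). By Matsumoto's theorem ([matsumoto]),
g_i g_w is g_(s_i w) when s_i w is longer than w; otherwise the quadratic
relation applies ([Yg_perm_up], [Yg_perm_down]). So the span of the family is
stable under left multiplication by all generators ([Yfamily_spans]). *)

Set Implicit Arguments.
Unset Strict Implicit.
Unset Printing Implicit Defensive.

Import Order.TTheory GRing.Theory Num.Theory.
Local Open Scope ring_scope.
Local Open Scope quotient_scope.

(* The composition of permutations, not that of partial functions. *)
Local Notation pcomp := Defs.pcomp.

(** * Inversions, reduced words and the braid relations *)

Section Inversions.
Variable n' : nat.
Local Notation n := n'.+1.
Implicit Types (y : 'I_n -> int) (w : 'S_n) (i j : 'I_n') (s : seq 'I_n').

(** The indices are compared with integer values rather than with a permutation,
so that the same count applies to the coordinates of a point of an alcove. *)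
Definition ninv y : nat :=
  #|[set p : 'I_n * 'I_n | (p.1 < p.2)%N && (y p.2 < y p.1)]|.

Lemma ninv_swap y y' (a c : 'I_n) : (a < c)%N ->
  (forall k l : 'I_n, (k < l)%N -> (k, l) != (a, c) ->
     (y' l < y' k) = (y l < y k)) ->
  (ninv y' + (y c < y a)%R = ninv y + (y' c < y' a)%R)%N.
Proof.
move=> ac eqy; rewrite /ninv (cardsD1 (a, c)) [in RHS](cardsD1 (a, c)).
rewrite !inE /= ac /= [in RHS]addnAC addnAC [in LHS]addnC.
rewrite [in LHS]addnC; congr (_ + _)%N; first exact: addnC.
apply: eq_card => p; rewrite !inE; case: (boolP (p == _)) => //= ne.
by case: p ne => k l ne /=; case kl: (k < l)%N => //=; rewrite eqy.
Qed.

(** One value goes up by one, another one goes down by one, and no other value equals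
the start or the end of these moves: only the relative order of the two values that
move can change. *)
Lemma ninv_adjacent y y' (a c : 'I_n) : a != c ->
  y' a = y a + 1 -> y' c = y c - 1 ->
  (forall k, k != a -> k != c ->
     [/\ y' k = y k, y k != y a, y k != y a + 1, y k != y c & y k + 1 != y c]) ->
  (ninv y' <= (ninv y).+1)%N /\
  (y c = y a + 1 -> (a < c)%N -> ninv y' = (ninv y).+1).
Proof.
move=> ac ya yc yk.
have key (k l : 'I_n) : (k, l) != (a, c) -> (k, l) != (c, a) -> k != l ->
    (y' l < y' k) = (y l < y k).
  rewrite !xpair_eqE => n1 n2 n3.
  have [ka|ka] := eqVneq k a; have [la|la] := eqVneq l a;
  have [kc|kc] := eqVneq k c; have [lc|lc] := eqVneq l c;
  subst; rewrite ?eqxx ?ya ?yc //= in n1 n2 n3 ac *;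
  try (have [-> ? ? ? ?] := yk _ ka kc); try (have [-> ? ? ? ?] := yk _ la lc);
  rewrite ?ya ?yc //; lia.
have [lt_ac|lt_ca|eq_ac] := ltngtP a c;
  last by move/val_inj/eqP: eq_ac; rewrite (negPf ac).
- have H : (ninv y' + (y c < y a)%R = ninv y + (y' c < y' a)%R)%N.
    apply: ninv_swap (lt_ac) _ => k l kl ne; apply: key ne _ _; apply/eqP.
      by case=> ? ?; subst; lia.
    by move=> ?; subst; lia.
  by split=> [|yac _]; [lia | rewrite ya yc in H; lia].
- have H : (ninv y' + (y a < y c)%R = ninv y + (y' a < y' c)%R)%N.
    apply: ninv_swap (lt_ca) _ => k l kl ne; apply: key _ ne _; apply/eqP.
      by case=> ? ?; subst; lia.
    by move=> ?; subst; lia.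
  by split=> [|yac]; lia.
Qed.

Definition inversions w : nat := ninv (fun k : 'I_n => (w k : nat)%:Z).

(** Left descents: s_i w is shorter than w. *)
Definition ldesc i w := (w^-1%g (posr i) < w^-1%g (posl i))%N.

Lemma sref_posl i : sref i (posl i) = posr i. Proof. exact: tpermL. Qed.
Lemma sref_posr i : sref i (posr i) = posl i. Proof. exact: tpermR. Qed.
Lemma sref_out i (k : 'I_n) : k != i :> nat -> k != i.+1 :> nat -> sref i k = k.
Proof.
move=> h1 h2; apply: tpermD; apply/eqP => /(congr1 val) /=; rewrite ?/bump /=; lia.
Qed.
Lemma posl_val i : posl i = i :> nat. Proof. by []. Qed.
Lemma posr_val i : posr i = i.+1 :> nat. Proof. by rewrite /posr /=. Qed.
Lemma posl_neq i : posl i != posr i.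
Proof. by apply/eqP => /(congr1 val) /=; rewrite /bump /=; lia. Qed.

Lemma pcomp_srefK i w : pcomp (sref i) (pcomp (sref i) w) = w.
Proof. by rewrite /pcomp -mulgA tperm2 mulg1. Qed.

Lemma pcompVE i w (k : 'I_n) : (pcomp (sref i) w)^-1%g k = w^-1%g (sref i k).
Proof. by rewrite /pcomp invMg tpermV permM. Qed.

Lemma ldesc_sref i w : ldesc i (pcomp (sref i) w) = ~~ ldesc i w.
Proof.
rewrite /ldesc !pcompVE sref_posl sref_posr -leqNgt [RHS]leq_eqVlt.
rewrite orb_idl // => /eqP /val_inj/perm_inj/eqP.
by rewrite (negPf (posl_neq i)).
Qed.

(** Left multiplication by s_i exchanges the adjacent values i and i+1. *)
Lemma inversions_up i w :
  ~~ ldesc i w -> inversions (pcomp (sref i) w) = (inversions w).+1.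
Proof.
move=> nd; pose a := w^-1%g (posl i); pose c := w^-1%g (posr i).
have ac : a != c by rewrite /a /c (inj_eq perm_inj) posl_neq.
have lt_ac : (a < c)%N by rewrite ltn_neqAle ac /= leqNgt.
have wa : w a = posl i by rewrite /a permKV.
have wc : w c = posr i by rewrite /c permKV.
rewrite /inversions; apply: (ninv_adjacent ac _ _ _).2 => //.
- by rewrite /pcomp permM wa sref_posl posr_val posl_val; lia.
- by rewrite /pcomp permM wc sref_posr posr_val posl_val; lia.
- move=> k ka kc; rewrite /pcomp permM wa wc posr_val /=.
  have h1 : w k != i :> nat.
    by apply: contra ka; rewrite -(inj_eq (@perm_inj _ w)) wa.
  have h2 : w k != i.+1 :> nat.
    by apply: contra kc; rewrite -(inj_eq (@perm_inj _ w)) wc -val_eqE /= /bump.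
  by rewrite sref_out //; split=> //; lia.
- by rewrite wa wc posr_val /=; lia.
Qed.

Lemma inversions_down i w :
  ldesc i w -> inversions w = (inversions (pcomp (sref i) w)).+1.
Proof.
by move=> dw; rewrite -(inversions_up (i := i)) ?pcomp_srefK // ldesc_sref negbK.
Qed.

Lemma inversions1 : inversions 1%g = 0%N.
Proof.
rewrite /inversions /ninv; apply/eqP; rewrite cards_eq0; apply/eqP/setP => -[k l].
by rewrite !inE /= !perm1; lia.
Qed.

Lemma inversions_word_perm s : (inversions (word_perm s) <= size s)%N.
Proof.
elim: s => [|i s IHs] /=; first by rewrite inversions1.
case di: (ldesc i (word_perm s)); last by rewrite inversions_up ?di.
by move/inversions_down: di; lia.
Qed.

(** A permutation and the identity have the same sum of values. *)
Lemma perm_geq_id w : (forall k : 'I_n, k <= w k)%N -> w = 1%g.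
Proof.
move=> wk; have sumE : (\sum_(k : 'I_n) k = \sum_(k : 'I_n) w k)%N.
  by rewrite (reindex_inj (@perm_inj _ w)).
have /= := @leqif_sum _ predT _ _ _ (fun k _ => leqif_eq (wk k)).
case=> _; rewrite sumE eqxx => /esym/forallP/= h.
by apply/permP => k; rewrite perm1; apply/val_inj/esym/eqP/h.
Qed.

(** Without left descents the inverse of w is increasing, hence the identity. *)
Lemma ex_ldesc w : w != 1%g -> exists i, ldesc i w.
Proof.
move=> w1; apply/existsP; apply: contraT => /existsPn nd.
have : w^-1%g != 1%g by rewrite invg_eq1.
case/eqP; apply: perm_geq_id => -[k]; elim: k => [//|k IHk] lk.
have lk' : (k < n')%N by [].
have := IHk (ltnW lk); have := nd (Ordinal lk'); rewrite /ldesc -leqNgt.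
rewrite leq_eqVlt => /orP[/eqP/val_inj/perm_inj/eqP|].
  by rewrite (negPf (posl_neq _)).
have -> : posl (Ordinal lk') = Ordinal (ltnW lk) by apply: val_inj.
have -> : posr (Ordinal lk') = Ordinal lk by apply: val_inj.
by rewrite /=; lia.
Qed.

Lemma ex_word w : exists2 s, word_perm s = w & size s = inversions w.
Proof.
have [m] := ubnP (inversions w); elim: m w => // m IHm w lt_w.
have [->|/ex_ldesc[i di]] := eqVneq w 1%g.
  by exists [::] => //=; rewrite inversions1.
have invE := inversions_down di.
have [|s sE sz] := IHm (pcomp (sref i) w); first by lia.
by exists (i :: s) => /=; rewrite ?sE ?pcomp_srefK // sz invE.
Qed.

Lemma reducedP w s : reduced w s <-> word_perm s = w /\ size s = inversions w.
Proof.
split=> [[sw min_s]|[sw sz]]; split=> //.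
  have [s' s'w s'z] := ex_word w.
  have := min_s _ s'w; have := inversions_word_perm s; rewrite sw; lia.
by move=> s' s'w; rewrite sz -s'w inversions_word_perm.
Qed.

Lemma reduced_wordP w :
  word_perm (reduced_word w) = w /\ size (reduced_word w) = inversions w.
Proof.
apply/reducedP; rewrite /reduced_word.
apply: (@xgetPex _ [::] [set s | reduced w s]%classic).
by have [s sw sz] := ex_word w; exists s; apply/reducedP.
Qed.

Lemma reduced_cons i s w : word_perm (i :: s) = w -> (size s).+1 = inversions w ->
  [/\ ldesc i w, word_perm s = pcomp (sref i) w
    & size s = inversions (pcomp (sref i) w)].
Proof.
move=> /= <-; rewrite pcomp_srefK ldesc_sref => sz.
have := inversions_word_perm s.
case: (boolP (ldesc i _)) => [/inversions_down|/inversions_up] e.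
  by rewrite e in sz *; lia.
by split=> //; lia.
Qed.

Lemma sref_comm i j : (i.+1 < j)%N -> forall w,
  pcomp (sref i) (pcomp (sref j) w) = pcomp (sref j) (pcomp (sref i) w).
Proof.
move=> ij w; rewrite /pcomp -!mulgA; congr (_ * _)%g.
rewrite conjgC; congr (_ * _)%g; rewrite {1}/sref tpermJ.
by rewrite !sref_out // ?posr_val ?posl_val; lia.
Qed.

Lemma posl_posr i j : j = i.+1 :> nat -> posl j = posr i.
Proof. by move=> ij; apply: val_inj; rewrite /= ij. Qed.

Lemma sref_braid i j : j = i.+1 :> nat -> forall w,
  pcomp (sref i) (pcomp (sref j) (pcomp (sref i) w)) =
  pcomp (sref j) (pcomp (sref i) (pcomp (sref j) w)).
Proof.
move=> ij w; rewrite /pcomp -!mulgA; congr (_ * _)%g.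
have conj3 (a c : 'S_n) : (a * a = 1 -> a * (c * a) = c ^ a)%g.
  by move=> aa; rewrite conjgE (_ : a^-1 = a)%g // -[LHS]mulg1 -aa mulKg.
have srefJ (k l : 'I_n') :
  (sref k ^ sref l)%g = tperm (sref l (posl k)) (sref l (posr k)) by exact: tpermJ.
have pij := posl_posr ij.
rewrite !conj3 ?tperm2 // !srefJ pij sref_posr -pij sref_posl.
by rewrite !sref_out // ?posr_val ?posl_val; lia.
Qed.

(** Matsumoto's theorem for the symmetric group. If two reduced words of w begin
with distinct letters i and j, then w has both as left descents, so it also has two
reduced words that begin with the two sides of the relation between s_i and s_j
(commutation or braid) and continue with a common tail. The induction on the length
compares each given word with the one of these that has the same first letter. *)
Lemma matsumoto (A : pzRingType) (f : 'I_n' -> A) :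
  (forall i j, (i.+1 < j)%N -> f i * f j = f j * f i) ->
  (forall i j, j = i.+1 :> nat -> f i * f j * f i = f j * f i * f j) ->
  forall w s s', word_perm s = w -> size s = inversions w ->
    word_perm s' = w -> size s' = inversions w ->
  \prod_(i <- s) f i = \prod_(i <- s') f i.
Proof.
move=> fC fB w s s'; have [m] := ubnP (inversions w).
elim: m w s s' => // m IHm w [|i u] [|j v] lt_m //= sw sz s'w s'z; try lia.
have [di uw uz] := reduced_cons sw sz; have [dj vw vz] := reduced_cons s'w s'z.
rewrite !big_cons.
have inv_i := inversions_down di; have inv_j := inversions_down dj.
wlog: i j u v sw sz s'w s'z di uw uz dj vw vz inv_i inv_j / (i <= j)%N.
  move=> IH; have [ij|ji] := leqP i j; first exact: IH.
  by apply/esym; apply: IH => //; apply: ltnW.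
rewrite leq_eqVlt => /orP[/eqP/val_inj ij|ij].
  by subst j; congr (_ * _); apply: (IHm (pcomp (sref i) w)) => //; lia.
case: (ltngtP i.+1 j) ij => // [ij|ij] _.
- have dj' : ldesc j (pcomp (sref i) w).
    by rewrite /ldesc !pcompVE !sref_out // ?posr_val ?posl_val; lia.
  (* z is the common tail of the words i j z and j i z of w. *)
  have [z zw zz] := ex_word (pcomp (sref j) (pcomp (sref i) w)).
  have invz := inversions_down dj'.
  have eu : \prod_(k <- u) f k = \prod_(k <- j :: z) f k.
    apply: (IHm (pcomp (sref i) w)) => //; first by lia.
      by rewrite [LHS]/= zw pcomp_srefK.
    by rewrite invz -zz.
  have ev : \prod_(k <- v) f k = \prod_(k <- i :: z) f k.
    apply: (IHm (pcomp (sref j) w)) => //; first by lia.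
      by rewrite [LHS]/= zw -(sref_comm ij) pcomp_srefK.
    by move=> /=; lia.
  by rewrite eu ev !big_cons !mulrA fC.
have {}ij := esym ij; have pij := posl_posr ij.
have rj_out : sref i (posr j) = posr j.
  by rewrite sref_out // posr_val; lia.
have dj' : ldesc j (pcomp (sref i) w).
  rewrite /ldesc !pcompVE rj_out pij sref_posr.
  by apply: ltn_trans di; rewrite -pij.
have invj' := inversions_down dj'.
have li_out : sref j (posl i) = posl i.
  by rewrite sref_out // posl_val; lia.
have di' : ldesc i (pcomp (sref j) (pcomp (sref i) w)).
  by rewrite /ldesc !pcompVE li_out sref_posl -pij sref_posl rj_out.
have invi' := inversions_down di'.
(* z is the common tail of the words i j i z and j i j z of w. *)
have [z zw zz] := ex_word (pcomp (sref i) (pcomp (sref j) (pcomp (sref i) w))).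
have eu : \prod_(k <- u) f k = \prod_(k <- [:: j, i & z]) f k.
  apply: (IHm (pcomp (sref i) w)) => //; first by lia.
    by rewrite [LHS]/= zw !pcomp_srefK.
  by rewrite invj' invi' -zz.
have ev : \prod_(k <- v) f k = \prod_(k <- [:: i, j & z]) f k.
  apply: (IHm (pcomp (sref j) w)) => //; first by lia.
    by rewrite [LHS]/= zw (sref_braid ij) !pcomp_srefK.
  by move=> /=; lia.
by rewrite eu ev !big_cons !mulrA fB.
Qed.

End Inversions.

(** * The length of a permutation in the extended affine group *)

Section Length.
Variables d' n' : nat.
Local Notation n := n'.+1.
Local Notation W := (Wt d' n').
Implicit Types (u x : W) (w : 'S_n) (i : 'I_n').

Lemma WtE u v : tor u = tor v -> lat u = lat v -> prm u = prm v -> u = v :> W.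
Proof. by case: u v => [? ? ?] [? ? ?] /= -> -> ->. Qed.

Lemma Wtor0 : Wtor 0 = 1%g :> W. Proof. by []. Qed.

Lemma WlatD : {morph @Wlat d' n' : l m / l + m >-> (l * m)%g}.
Proof. by move=> l m; apply: WtE; rewrite /= ?pact1 ?addr0 // /pcomp mulg1. Qed.

Lemma WtorD : {morph @Wtor d' n' : a c / a + c >-> (a * c)%g}.
Proof. by move=> a c; apply: WtE; rewrite /= ?pact1 ?addr0 // /pcomp mulg1. Qed.

Lemma tgenX (j : 'I_n) m :
  (tgen d' j ^+ m)%g = Wtor ([ffun k => inZp (k == j)] *+ m).
Proof. by elim: m => [|m IHm] //; rewrite expgS IHm mulrS WtorD. Qed.

Lemma prod_Wprm (s : seq 'I_n') :
  (\prod_(i <- s) Wprm d' (sref i))%g = Wprm d' (word_perm s).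
Proof.
elim: s => [|i s IHs]; first by rewrite big_nil.
by rewrite big_cons IHs; apply: WtE; rewrite /= ?pact0 ?addr0.
Qed.

(** The partial products of gamma = s_(n-1) ... s_1 send 1 to k+1 and, when they are
not empty, 2 to 1; these two values determine s_0. *)
Lemma word_perm_rev_take k (x0 : 'I_n') : (k <= n')%N ->
  let w := word_perm (rev (take k (enum 'I_n'))) in
  w ord0 = inord k /\ ((0 < k)%N -> w (inord 1) = ord0).
Proof.
elim: k => [_|k IHk lk] /=.
  by rewrite take0 /= perm1; split=> //; apply: val_inj; rewrite /= inordK.
have [|w0 w1] := IHk; first exact: ltnW.
rewrite (take_nth x0) ?size_enum_ord // rev_rcons /= /pcomp !permM w0.
set i := nth _ _ _; have iE : i = k :> nat by rewrite /i nth_enum_ord.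
have pk : inord k = posl i.
  by apply: val_inj; rewrite /= iE inordK //; lia.
split=> [|_].
  by rewrite pk sref_posl; apply: val_inj; rewrite /= iE inordK //=; lia.
have [k0|k0] := posnP k; last first.
  by rewrite w1 // sref_out //=; lia.
rewrite {1}k0 take0 /= perm1.
have -> : inord 1 = posr i by apply: val_inj; rewrite /= iE k0 inordK //; lia.
by rewrite sref_posr; apply: val_inj; rewrite /= iE k0.
Qed.

Lemma s0W_E : (0 < n')%N ->
  s0W d' n' = MkWt 0 [ffun k => (k == ord_max)%:R - (k == ord0)%:R]
                   (tperm ord0 ord_max).
Proof.
move=> n0; have [] := word_perm_rev_take (Ordinal n0) (leqnn n').
rewrite -[X in take X]size_enum_ord take_size; set g := word_perm _.
move=> g0 /(_ n0) g1; rewrite (_ : inord n' = ord_max) in g0; last first.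
  by apply: val_inj; rewrite /= inordK.
have hE : hW d' n' = MkWt 0 [ffun k => (k == ord_max)%:R] g.
  rewrite /hW prod_Wprm; apply: WtE; rewrite /= ?pact0 ?addr0 ?pact1 ?pact0 ?addr0 //.
  by rewrite /pcomp mulg1.
have tE : pcomp (pcomp g (tperm ord0 (inord 1))) g^-1 = tperm ord0 ord_max.
  by rewrite /pcomp -conjgE tpermJ g0 g1 tpermC.
apply: WtE; rewrite /s0W hE /= ?tE //.
  by rewrite !(pact0, pactN, addr0, oppr0).
rewrite pactN -pact_pcomp tE pact0 addr0; apply/ffunP => k; rewrite !ffunE /=.
congr (_ - (_ : bool)%:R); rewrite tpermV.
by rewrite -[in RHS](inj_eq (@perm_inj _ (tperm ord0 ord_max))) tpermL.
Qed.

(** The image under u of the point (0, 1, ..., n-1) of the fundamental alcove, in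
coordinates where the translation lattice is n Z^n. *)
Definition alcove u : 'I_n -> int :=
  fun k => n%:Z * lat u k + ((prm u)^-1%g k : nat)%:Z.

Lemma eq_mod_add (a c r s : int) : 0 <= r < n%:Z -> 0 <= s < n%:Z ->
  n%:Z * a + r = n%:Z * c + s -> r = s.
Proof.
move=> hr hs /(congr1 (fun z => z %% n%:Z)%Z).
by rewrite !(mulrC n%:Z) !modzMDl !modz_small.
Qed.

(** The coordinates of the alcove have distinct residues modulo n. *)
Lemma alcove_neq u (k : 'I_n) (c : int) (r : 'I_n) : k != prm u r ->
  alcove u k != n%:Z * c + (r : nat)%:Z.
Proof.
apply: contra => /eqP /eq_mod_add e.
have /eqP : ((prm u)^-1%g k : nat)%:Z = (r : nat)%:Z.
  by apply: e; have := ltn_ord r; have := ltn_ord ((prm u)^-1%g k); lia.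
by rewrite eqz_nat => /eqP/val_inj <-; rewrite permKV.
Qed.

(** The coordinate of residue i (counted from 0) increases by one and that of residue
i+1 decreases by one. *)
Lemma ninv_alcove_sref u i :
  (ninv (alcove (u * Wprm d' (sref i))%g) <= (ninv (alcove u)).+1)%N.
Proof.
pose a := prm u (posl i); pose c := prm u (posr i).
have yE k : alcove (u * Wprm d' (sref i))%g k =
    n%:Z * lat u k + (sref i ((prm u)^-1%g k) : nat)%:Z.
  by rewrite /alcove /= pact0 addr0 /pcomp invMg permM /sref tpermV.
have ya : alcove u a = n%:Z * lat u a + i%:Z by rewrite /alcove permK.
have yc : alcove u c = n%:Z * lat u c + i.+1%:Z.
  by rewrite /alcove permK posr_val.
apply: (ninv_adjacent (a := a) (c := c) _ _ _ _).1.
- by rewrite (inj_eq perm_inj) posl_neq.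
- by rewrite yE ya permK sref_posl posr_val; lia.
- by rewrite yE yc permK sref_posr posl_val; lia.
move=> k ka kc; split.
- rewrite yE sref_out //.
    apply: contra ka => /eqP e; rewrite -(permKV (prm u) k).
    by apply/eqP; congr (_ _); apply: val_inj.
  apply: contra kc => /eqP e; rewrite -(permKV (prm u) k).
  by apply/eqP; congr (_ _); apply: val_inj; rewrite /= e.
- by rewrite ya (alcove_neq (lat u a) ka).
- by rewrite ya -addrA (_ : _ + 1 = (posr i : nat)%:Z) ?alcove_neq // posr_val; lia.
- by rewrite yc -posr_val alcove_neq.
- rewrite yc -subr_eq0 (_ : _ - _ = alcove u k -
    (n%:Z * lat u c + (posl i : nat)%:Z)) ?subr_eq0 ?alcove_neq //.
  by rewrite posl_val; lia.
Qed.

(** The coordinate of residue n-1 increases by one and that of residue 0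
decreases by one. *)
Lemma ninv_alcove_s0 u : (0 < n')%N ->
  (ninv (alcove (u * s0W d' n')%g) <= (ninv (alcove u)).+1)%N.
Proof.
move=> n0; rewrite s0W_E //.
pose a := prm u ord_max; pose c := prm u ord0.
have m0 : ord_max != ord0 :> 'I_n by rewrite -val_eqE /=; lia.
have yE k : alcove (u * MkWt 0 [ffun k => (k == ord_max)%:R - (k == ord0)%:R]
                   (tperm ord0 ord_max))%g k =
    n%:Z * (lat u k + ((k == a)%:R - (k == c)%:R))
      + (tperm ord0 ord_max ((prm u)^-1%g k) : nat)%:Z.
  rewrite /alcove /= /pcomp invMg permM tpermV !ffunE.
  have e r : ((prm u)^-1%g k == r) = (k == prm u r).
    by rewrite -{2}(permKV (prm u) k) (inj_eq perm_inj).
  by rewrite !e.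
have ya : alcove u a = n%:Z * lat u a + n'%:Z by rewrite /alcove permK.
have yc : alcove u c = n%:Z * lat u c by rewrite /alcove permK addr0.
have ac : a != c by rewrite (inj_eq perm_inj).
apply: (ninv_adjacent (a := a) (c := c) _ _ _ _).1 => //.
- by rewrite yE ya permK tpermR eqxx (negPf ac) /=; lia.
- by rewrite yE yc permK tpermL eqxx eq_sym (negPf ac) /=; lia.
move=> k ka kc; split.
- rewrite yE (negPf ka) (negPf kc) /alcove tpermD /= ?(mulr0n, subr0, addr0) //.
    by apply: contra kc => /eqP e; rewrite /c e permKV.
  by apply: contra ka => /eqP e; rewrite /a e permKV.
- by rewrite ya (alcove_neq _ ka).
- rewrite ya (_ : _ + 1 = n%:Z * (lat u a + 1) + (ord0 : 'I_n)%:Z) ?alcove_neq //=.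
  by lia.
- by rewrite yc -[_ * _]addr0 (alcove_neq _ kc).
- rewrite yc -subr_eq0 (_ : _ - _ = alcove u k -
    (n%:Z * (lat u c - 1) + (ord_max : 'I_n)%:Z)) ?subr_eq0 ?alcove_neq //=.
  by lia.
Qed.

Lemma Saff_inv x : Saff x -> (x^-1)%g = x.
Proof.
move=> sx; apply: (@mulgI _ x); rewrite mulgV; apply/esym.
case: sx => [[i ->]|[n0 ->]]; first by
  apply: WtE => /=; rewrite ?pact0 ?addr0 // /pcomp /sref tperm2.
rewrite s0W_E //; apply: WtE => /=; rewrite ?pact0 ?addr0 // /pcomp ?tperm2 //.
apply/ffunP => k; rewrite !ffunE tpermV.
have e r : (tperm ord0 ord_max k == r) = (k == tperm ord0 ord_max r).
  by rewrite -(inj_eq (@perm_inj _ (tperm ord0 ord_max))) tpermK.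
by rewrite !e tpermL tpermR; lia.
Qed.

(** Letters are added on the left of a word, that is on the right of its inverse:
this is why the inverse occurs. *)
Lemma ninv_alcove_word (s : seq W) : {in s, forall x, Saff x} ->
  (ninv (alcove (\prod_(x <- s) x)^-1%g) <= size s)%N.
Proof.
elim: s => [_|x s IHs xs].
  rewrite big_nil invg1 /ninv leqn0 cards_eq0; apply/eqP/setP => -[k l].
  by rewrite !inE /alcove /= !ffunE !invg1 !perm1; lia.
rewrite big_cons invgM /=; have sx : Saff x by apply: xs; rewrite inE eqxx.
rewrite (Saff_inv sx); apply: leq_trans (_ : _ <= _.+1)%N _; last first.
  by apply: IHs => y ys; apply: xs; rewrite inE ys orbT.
by case: sx => [[i ->]|[n0 ->]]; [apply: ninv_alcove_sref|apply: ninv_alcove_s0].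
Qed.

Lemma ninv_alcove_prm w : ninv (alcove (Wprm d' w)^-1%g) = inversions w.
Proof.
rewrite /inversions /ninv; apply: eq_card => -[k l]; rewrite !inE /alcove /= invgK.
by rewrite pact0 oppr0 !ffunE mulr0 !add0r.
Qed.

Lemma aff_length_prm w : is_aff_length (Wprm d' w) (inversions w).
Proof.
split=> [|s [sS sw]]; last by rewrite -ninv_alcove_prm -sw ninv_alcove_word.
have [s sw sz] := ex_word w.
exists [seq Wprm d' (sref i) | i <- s]; rewrite ?size_map //; split.
  by move=> x /mapP[i _ ->]; left; exists i.
by rewrite big_map prod_Wprm sw.
Qed.

(** The sum of the lattice coordinates is a morphism to Z that vanishes on the
affine Weyl group and takes the value 1 at h, so it detects the power of h. *)
Definition lat_sum u : int := \sum_k lat u k.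

Lemma lat_sumM u v : lat_sum (u * v)%g = lat_sum u + lat_sum v.
Proof.
rewrite /lat_sum [X in _ + X](reindex_inj (@perm_inj _ (prm u)^-1%g)).
by rewrite -big_split; apply: eq_bigr => k _; rewrite !ffunE.
Qed.

Lemma lat_sum1 : lat_sum 1%g = 0.
Proof. by rewrite /lat_sum big1 // => k _; rewrite ffunE. Qed.

Lemma lat_sumV u : lat_sum u^-1%g = - lat_sum u.
Proof. by apply: (addrI (lat_sum u)); rewrite -lat_sumM mulgV lat_sum1 subrr. Qed.

Lemma lat_sumX u m : lat_sum (u ^+ m)%g = lat_sum u *+ m.
Proof. by elim: m => [|m IHm]; rewrite ?lat_sum1 // expgS lat_sumM IHm mulrS. Qed.

Lemma lat_sum_h : lat_sum (hW d' n') = 1.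
Proof.
rewrite /hW prod_Wprm lat_sumM /lat_sum /= [X in _ + X]big1 => [|k _]; last first.
  by rewrite ffunE.
rewrite addr0 (bigD1 ord_max) //= ffunE eqxx big1 ?addr0 // => k kmax.
by rewrite ffunE (negPf kmax).
Qed.

Lemma lat_sum_expgz (k : int) : lat_sum (expgz (hW d' n') k) = k.
Proof.
by case: k => k; rewrite /= ?lat_sumV lat_sumX lat_sum_h ?NegzE -mulr_natr mul1r // natz.
Qed.

(** A morphism to Z vanishes on involutions. *)
Lemma Saff_lat_sum_tor x : Saff x -> lat_sum x = 0 /\ tor x = 0.
Proof.
case=> [[i ->]|[n0 ->]].
  by split=> //; rewrite /lat_sum big1 // => k _; rewrite ffunE.
split; last by rewrite s0W_E.
have := congr1 lat_sum (Saff_inv (or_intror (conj n0 erefl) : Saff (s0W d' n'))).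
rewrite lat_sumV; lia.
Qed.

Lemma aff_length_lat_sum_tor u l : is_aff_length u l -> lat_sum u = 0 /\ tor u = 0.
Proof.
case=> -[s [sS <-] _] _; elim: s sS => [_|x s IHs sS]; first by rewrite big_nil lat_sum1.
have [|ds ts] := IHs; first by move=> y ys; apply: sS; rewrite inE ys orbT.
have [|dx tx] := Saff_lat_sum_tor (sS x _); first by rewrite inE eqxx.
by rewrite big_cons lat_sumM dx ds; split=> //=; rewrite tx ts pact0 addr0.
Qed.

(** The decomposition t h^k w' of a permutation is the trivial one, so its length is
its word length in the affine Weyl group. *)
Lemma ell_prm w : ell (Wprm d' w) = inversions w.
Proof.
apply: (@xget_unique _ 0%N).
  exists 0, 0, (Wprm d' w); split; last exact: aff_length_prm.
  by rewrite /= mulg1; apply: WtE; rewrite /= ?pact1 ?add0r // /pcomp mulg1.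
move=> l [a [k [w' [wE lw']]]]; have [dw' tw'] := aff_length_lat_sum_tor lw'.
have k0 : k = 0.
  have /= := congr1 lat_sum wE; rewrite !lat_sumM dw' addr0 lat_sum_expgz.
  by rewrite /lat_sum !big1 => [|j _]; rewrite ?ffunE //=; lia.
have ww' : Wprm d' w = w'.
  have tE := congr1 (@tor _ _) wE; rewrite k0 /= mulg1 in wE tE.
  rewrite tw' !pact0 !addr0 in tE; rewrite wE -tE.
  by apply: WtE; rewrite /= ?pact1 ?add0r // /pcomp mulg1.
have [[s sw' sz] lb] := lw'; have [[s1 sw1 sz1] lb1] := aff_length_prm w.
by rewrite -ww' in sw' lb; have := lb _ sw1; have := lb1 _ sw'; lia.
Qed.

End Length.

(** * Algebras given by generators and relations; spanning families *)

Section UniversalProperty.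
Variables (R : comNzRingType) (G : choiceType) (H : algType R) (f : G -> H).
Local Notation F := (free_alg R G).

Definition eval_mon (m : {fmonom G}) : H := \prod_(x <- (m : seq G)) f x.

Lemma eval_mon_morph : mmorphism eval_mon.
Proof.
by split=> [x y|]; rewrite /eval_mon ?fmM ?big_cat // fm1 big_nil.
Qed.
HB.instance Definition _ := monalg.isMultiplicative.Build
  {fmonom G} H eval_mon eval_mon_morph.

Definition eval_free : F -> H := mmap (in_alg H) eval_mon.

Lemma eval_freeD : {morph eval_free : x y / x + y}.
Proof. exact: mmapD. Qed.

Lemma eval_free0 : eval_free 0 = 0.
Proof. exact: mmap0. Qed.

Lemma eval_freeB : {morph eval_free : x y / x - y}.
Proof. exact: mmapB. Qed.

Lemma eval_freeZ c : {morph eval_free : x / c *: x}.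
Proof. by move=> x; rewrite /eval_free mmapZ /= mulr_algl. Qed.

Lemma eval_freeM : {morph eval_free : x y / x * y}.
Proof.
apply: (commr_mmap_is_multiplicative _).1 => g m m'.
by rewrite /GRing.comm /= -scalerAl -scalerAr mul1r mulr1.
Qed.

Lemma eval_free1 : eval_free 1 = 1.
Proof. exact: mmap1. Qed.

Lemma eval_free_gen x : eval_free (free_gen R x) = f x.
Proof.
by rewrite /eval_free mmapU /eval_mon /= scale1r mul1r fmU big_seq1.
Qed.

Variable rels : F -> F -> Prop.
Hypothesis f_rels : forall x y, rels x y -> eval_free x = eval_free y.

Lemma eval_rel_ideal x : rel_ideal rels x -> eval_free x = 0.
Proof.
elim=> {x} [x y /f_rels xy||x y _ IHx _ IHy|a x c _ IHx].
- by rewrite eval_freeB xy subrr.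
- exact: mmap0.
- by rewrite eval_freeD IHx IHy addr0.
- by rewrite !eval_freeM IHx mulr0 mul0r.
Qed.

(** The value at a chosen representative; [eval_pres_pi] makes the choice immaterial. *)
Definition eval_pres (u : pres_alg rels) : H :=
  eval_free (generic_quotient.repr u).

Lemma eval_pres_pi (x : F) : eval_pres (\pi_(pres_alg rels) x) = eval_free x.
Proof.
apply/eqP; rewrite -subr_eq0 -eval_freeB; apply/eqP/eval_rel_ideal.
by apply/(rel_equivP rels)/eqmodP; rewrite /= reprK.
Qed.

Lemma eval_pres_gen x : eval_pres (pres_gen rels x) = f x.
Proof. by rewrite eval_pres_pi eval_free_gen. Qed.

Lemma eval_presD : {morph eval_pres : x y / x + y}.
Proof.
elim/quotW=> x; elim/quotW=> y.
by rewrite -[_ + _]/(pres_add _ _) !piE !eval_pres_pi eval_freeD.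
Qed.

Lemma eval_presM : {morph eval_pres : x y / x * y}.
Proof.
elim/quotW=> x; elim/quotW=> y.
by rewrite -[_ * _]/(pres_mul _ _) !piE !eval_pres_pi eval_freeM.
Qed.

Lemma eval_presZ c : {morph eval_pres : x / c *: x}.
Proof.
elim/quotW=> x.
by rewrite -[_ *: _]/(pres_scale _ _) !piE !eval_pres_pi eval_freeZ.
Qed.

Lemma eval_pres1 : eval_pres 1 = 1.
Proof. by rewrite -[1]/(pres1 rels) !piE eval_pres_pi eval_free1. Qed.

End UniversalProperty.

Section PresGen.
Variables (R : comNzRingType) (G : choiceType).
Local Notation F := (free_alg R G).
Variable rels : F -> F -> Prop.

Definition pres_class : F -> pres_alg rels := \pi_(pres_alg rels).

Lemma pres_classD : {morph pres_class : x y / x + y}.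
Proof. exact: (pi_pres_add rels). Qed.
Lemma pres_classM : {morph pres_class : x y / x * y}.
Proof. exact: (pi_pres_mul rels). Qed.
Lemma pres_classZ c : {morph pres_class : x / c *: x}.
Proof. exact: (pi_pres_scale rels c). Qed.
Lemma pres_class0 : pres_class 0 = 0.
Proof. by rewrite -[RHS]/(pres0 rels) /pres_class !piE. Qed.
Lemma pres_class1 : pres_class 1 = 1.
Proof. by rewrite -[RHS]/(pres1 rels) /pres_class !piE. Qed.

Lemma pres_class_rel x y : rels x y -> pres_class x = pres_class y.
Proof. by move=> xy; apply/eqmodP/(rel_equivP rels); apply: RelIdeal_rel. Qed.

(** Classes of monomials are products of generators, read from the left. *)
Lemma pres_ind (P : pres_alg rels -> Prop) :
  P 1 -> (forall x y, P x -> P y -> P (x + y)) ->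
  (forall c x, P x -> P (c *: x)) ->
  (forall g x, P x -> P (pres_gen rels g * x)) -> forall x, P x.
Proof.
move=> P1 PD PZ PM; elim/quotW => x; rewrite -[\pi_ _ _]/(pres_class x).
have P0 : P 0 by have := PZ 0 1 P1; rewrite scale0r.
have Pmon (m : seq G) : P (pres_class (<< FMonom m >> : F)).
  elim: m => [|g m IHm].
    by rewrite -[FMonom [::]]fmoneE -[<< fmone _ >>]/(1 : F) pres_class1.
  rewrite (_ : << _ >> = free_gen R g * << FMonom m >>) ?pres_classM; last first.
    rewrite /free_gen [RHS]malgM_def fgmulUU mulr1; congr << _ >>.
    by apply: val_inj; rewrite /= fmM fmU.
  exact: PM.
rewrite [x](monalgE (x : {malg R[{fmonom G}]})).
elim: (enum_fset _) => [|m s IHs]; first by rewrite big_nil pres_class0.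
rewrite big_cons pres_classD; apply: PD => //.
rewrite (_ : << _ *g m >> = x@_m *: << m >>); last first.
  by rewrite -mul_malgC malgM_def fgmulUU mulr1 mul1m.
by rewrite pres_classZ; apply: PZ; case: (m) => m'; apply: Pmon.
Qed.
End PresGen.

Section InSpan.
Variables (R : comNzRingType) (M : lmodType R) (I : eqType) (b : I -> M).

(** Coefficients are attached to the positions of a list, repetitions allowed,
which makes sums immediate; [span_collect] merges the repetitions. *)
Definition in_span (x : M) : Prop :=
  exists s : seq (R * I), x = \sum_(p <- s) p.1 *: b p.2.

Lemma in_span_gen i : in_span (b i).
Proof. by exists [:: (1, i)]; rewrite big_seq1 scale1r. Qed.

Lemma in_spanD x y : in_span x -> in_span y -> in_span (x + y).
Proof. by move=> [s ->] [t ->]; exists (s ++ t); rewrite big_cat. Qed.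

Lemma in_spanZ c x : in_span x -> in_span (c *: x).
Proof.
move=> [s ->]; exists [seq (c * p.1, p.2) | p <- s].
by rewrite big_map scaler_sumr; apply: eq_bigr => p _; rewrite scalerA.
Qed.

Lemma in_span0 : in_span 0.
Proof. by exists [::]; rewrite big_nil. Qed.

Lemma in_span_ind (P : M -> Prop) : P 0 -> (forall x y, P x -> P y -> P (x + y)) ->
  (forall c i, P (c *: b i)) -> forall x, in_span x -> P x.
Proof.
move=> P0 PD PZ x [s ->]; elim: s => [|p s IHs]; first by rewrite big_nil.
by rewrite big_cons; apply: PD.
Qed.

(** The merged coefficients serve for all families b' at once: the same
combination is read in the source and in the target of a linear map. *)
Lemma span_collect (s : seq (R * I)) : exists (t : seq I) (c : I -> R), uniq t /\
  forall (N : lmodType R) (b' : I -> N),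
    \sum_(p <- s) p.1 *: b' p.2 = \sum_(i <- t) c i *: b' i.
Proof.
exists (undup (map snd s)), (fun i => \sum_(p <- s | p.2 == i) p.1).
split=> [|N b']; first exact: undup_uniq.
under [RHS]eq_bigr do rewrite scaler_suml.
rewrite (exchange_big_dep predT) //= [LHS]big_seq [RHS]big_seq.
apply: eq_bigr => p ps; rewrite (big_rem p.2) /= ?eqxx; last first.
  by rewrite mem_undup map_f.
rewrite big_seq_cond big1 ?addr0 // => i /andP[+ /eqP pi].
by rewrite -pi mem_rem_uniq ?undup_uniq // inE eqxx.
Qed.

Lemma in_span_free_inj (N : lmodType R) (phi : {linear M -> N}) (x : M) :
  is_basis (phi \o b) -> in_span x -> phi x = 0 -> x = 0.
Proof.
move=> [_ free] [s ->]; have [t [c [tu tE]]] := span_collect s.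
rewrite tE linear_sum; under eq_bigr do rewrite linearZ.
move=> /(free _ _ tu) c0; rewrite big_seq big1 // => i /c0 ->.
by rewrite scale0r.
Qed.

End InSpan.

(** * Relations satisfied by the Bernstein basis *)

Section Idem.
Variables (R : comUnitRingType) (A : algType R) (d' : nat).

(** Conjugation by g exchanges x and y, and reverses the order of the sum: the term of
index k becomes that of index d - k, the index 0 being fixed since x^d = y^d = 1. *)
Lemma idem_commute (g x y : A) : x * y = y * x -> x ^+ d'.+1 = 1 -> y ^+ d'.+1 = 1 ->
  g * x = y * g -> g * y = x * g -> g * idem d' x y = idem d' x y * g.
Proof.
move=> xy xd yd gx gy; rewrite /idem -scalerAr -scalerAl; congr (_ *: _).
have gX u v k : g * u = v * g -> g * u ^+ k = v ^+ k * g.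
  move=> guv; elim: k => [|k IHk]; first by rewrite !expr0 mulr1 mul1r.
  by rewrite !exprS mulrA guv -mulrA IHk mulrA.
have xyX k l : x ^+ k * y ^+ l = y ^+ l * x ^+ k.
  by apply: commrX; apply: commr_sym; apply: commrX.
rewrite mulr_sumr mulr_suml big_nat_recl // [RHS]big_nat_recl //.
rewrite !expr0 subn0 !mul1r yd mulr1 mul1r; congr (_ + _).
rewrite [RHS]big_nat_rev /= big_nat [RHS]big_nat; apply: eq_bigr => k /andP[_ kd].
rewrite mulrA (gX _ _ _ gx) -mulrA (gX _ _ _ gy) mulrA -xyX.
by congr (_ ^+ _ * _ ^+ _ * _); lia.
Qed.

Lemma idem_commr (z x y : A) : z * x = x * z -> z * y = y * z ->
  z * idem d' x y = idem d' x y * z.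
Proof.
move=> zx zy; rewrite /idem -scalerAr -scalerAl; congr (_ *: _).
by apply: commr_sum => k _; apply: commrM; apply: commrX.
Qed.
End Idem.

Section Images.
Variables (K : realType) (b : qparam K) (d' n' : nat).
Local Notation d := d'.+1.
Local Notation n := n'.+1.
Local Notation R := (base b).
Local Notation q := (qof b).
Local Notation W := (Wt d' n').
Variables (H : algType R) (T E : W -> H).
Hypothesis HE : is_Bernstein T E.
Implicit Types (i : 'I_n') (j k : 'I_n) (a : {ffun 'I_n -> 'I_d}).

(** E(1) E(w) = E(w) makes E(1) a left unit on a basis. *)
Lemma E_one : E 1%g = 1.
Proof.
have [sp _] := B_basis HE; have [s [c e1]] := sp 1.
rewrite -[LHS]mulr1 [X in _ * X]e1 mulr_sumr [RHS]e1; apply: eq_bigr => w _.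
by rewrite -scalerAr (B_prod HE) ?mul1g.
Qed.

Lemma E_prm1_comm (x y : W) : prm x = 1%g -> prm y = 1%g -> E x * E y = E y * E x.
Proof.
move=> px py; rewrite !(B_prod HE) //; congr (E _).
by apply: WtE; rewrite /= px py ?pact1 // addrC.
Qed.

Definition Et j := E (tgen d' j).
Definition Eg i := E (Wprm d' (sref i)).
Definition delta j : {ffun 'I_n -> int} := [ffun k => (k == j)%:R].
Definition EX j := E (Wlat d' (delta j)).
Definition EXinv j := E (Wlat d' (- delta j)).

Lemma E_tgenX j m : E (tgen d' j ^+ m)%g = Et j ^+ m.
Proof.
elim: m => [|m IHm]; first by rewrite expr0 -E_one.
by rewrite exprS -IHm expgS (B_prod HE).
Qed.

Lemma prm_tgenX j m : prm (tgen d' j ^+ m)%g = 1%g.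
Proof. by rewrite tgenX. Qed.

Lemma Wtor0_mul (w : 'S_n) : (Wtor (0 : {ffun 'I_n -> 'I_d}) * Wprm d' w)%g = Wprm d' w.
Proof. by rewrite Wtor0 mul1g. Qed.

Lemma cparE j k : cpar E 0 j k = (q - q^-1) *: idem d' (Et j) (Et k).
Proof.
congr (_ *: (_ *: _)); apply: eq_bigr => m _.
rewrite Wtor0 mul1g -!E_tgenX (B_prod HE) //.
exact: prm_tgenX.
Qed.

Lemma inversions_sref i : inversions (sref i) = 1%N.
Proof.
have nd : ~~ ldesc i 1%g.
  by rewrite /ldesc invg1 !perm1 posr_val posl_val -leqNgt.
rewrite -[sref i]mul1g -[(1 * _)%g]/(pcomp _ 1%g) inversions_up //.
by rewrite inversions1.
Qed.

(** Along a reduced word the lengths add up, so E is multiplicative. *)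
Lemma E_word (s : seq 'I_n') : size s = inversions (word_perm s) ->
  \prod_(i <- s) Eg i = E (Wprm d' (word_perm s)).
Proof.
elim: s => [_|i s IHs sz]; first by rewrite big_nil -E_one.
have [di sw sz'] := reduced_cons erefl sz.
rewrite -sw in sz'; rewrite big_cons IHs // (B_braid HE) //.
  by congr (E _); apply: WtE => //=; rewrite pact0 addr0.
have -> : (Wprm d' (sref i) * Wprm d' (word_perm s))%g = Wprm d' (word_perm (i :: s)).
  by apply: WtE => //=; rewrite pact0 addr0.
by rewrite !ell_prm inversions_sref -sz -sz'.
Qed.

Lemma Eg_comm i i' : (i.+1 < i')%N -> Eg i * Eg i' = Eg i' * Eg i.
Proof.
move=> ii'; have wE : word_perm [:: i; i'] = word_perm [:: i'; i].
  by rewrite /= (sref_comm ii').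
have red2 (l l' : 'I_n') : (l.+1 < l')%N || (l'.+1 < l)%N ->
    2 = inversions (word_perm [:: l; l']).
  move=> h; rewrite /= inversions_up; first by rewrite /pcomp mul1g inversions_sref.
  rewrite /ldesc !pcompVE invg1 !perm1 !sref_out // ?posr_val ?posl_val; lia.
have ii'2 : (i'.+1 < i)%N || (i.+1 < i')%N by rewrite ii' orbT.
have := @E_word [:: i; i'] (red2 i i' (introT orP (or_introl ii'))).
have := @E_word [:: i'; i] (red2 i' i ii'2).
by rewrite !big_cons !big_nil !mulr1 wE => -> ->.
Qed.

(** Both sides are products along reduced words of the same permutation. *)
Lemma Eg_braid i i' : i' = i.+1 :> nat -> Eg i * Eg i' * Eg i = Eg i' * Eg i * Eg i'.
Proof.
move=> ii'; have pij := posl_posr ii'.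
have li : sref i' (posl i) = posl i by rewrite sref_out // posl_val; lia.
have ri : sref i (posr i') = posr i' by rewrite sref_out // posr_val; lia.
have red3 : 3 = inversions (word_perm [:: i; i'; i]).
  rewrite /= inversions_up; last first.
    rewrite /ldesc !pcompVE invg1 !perm1 li sref_posl -pij sref_posl ri.
    by rewrite -leqNgt posr_val posl_val; lia.
  rewrite inversions_up; first by rewrite /pcomp mul1g inversions_sref.
  by rewrite /ldesc !pcompVE invg1 !perm1 ri pij sref_posr -leqNgt posr_val posl_val; lia.
have red3' : 3 = inversions (word_perm [:: i'; i; i']).
  rewrite /= inversions_up; last first.
    rewrite /ldesc !pcompVE invg1 !perm1 ri sref_posr pij sref_posr li.
    by rewrite -leqNgt posr_val posl_val; lia.
  rewrite inversions_up; first by rewrite /pcomp mul1g inversions_sref.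
  rewrite /ldesc !pcompVE invg1 !perm1 li -pij sref_posl.
  by rewrite -leqNgt posr_val posl_val; lia.
have := @E_word [:: i; i'; i] red3; have := @E_word [:: i'; i; i'] red3'.
rewrite !big_cons !big_nil !mulr1 !mulrA.
by rewrite /= (sref_braid ii') => -> ->.
Qed.

Lemma Eg_quad i :
  Eg i ^+ 2 = 1 + (q - q^-1) *: (idem d' (Et (posl i)) (Et (posr i)) * Eg i).
Proof.
have := B_quad HE 0 i; rewrite /= Wtor0_mul cparE -scalerAl -/(Eg i) => ->.
congr (_ + _); rewrite -E_one; congr (E _); apply: WtE => /=; rewrite ?pact0 ?addr0 //.
by rewrite /pcomp /sref tperm2.
Qed.

Lemma conj_sref i a (l : {ffun 'I_n -> int}) :
  (Wprm d' (sref i) * (Wtor a * Wlat d' l) * (Wprm d' (sref i))^-1)%g =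
  MkWt (pact (sref i) a) (pact (sref i) l) 1%g.
Proof.
apply: WtE; rewrite /= ?pact1 ?(pact0, addr0, add0r, oppr0) ?pactN ?pact0 ?oppr0 ?addr0 //.
by rewrite /pcomp !mulg1 !mul1g mulVg.
Qed.

(** The Bernstein relation without correction term, as s_i fixes the lattice part. *)
Lemma E_sref i a (l : {ffun 'I_n -> int}) : pact (sref i) l = l ->
  Eg i * E (MkWt a l 1%g) = E (MkWt (pact (sref i) a) l 1%g) * Eg i.
Proof.
move=> sl; have := B_rel HE 0 a i l; rewrite /= Wtor0_mul conj_sref sl eqxx.
rewrite [(Wtor a * _)%g](_ : _ = MkWt a l 1%g); last first.
  by apply: WtE; rewrite /= ?pact1 ?addr0 ?add0r // /pcomp mulg1.
by move/eqP; rewrite subr_eq0 => /eqP ->.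
Qed.

Lemma Eg_Et i j : Eg i * Et j = Et (sref i j) * Eg i.
Proof.
rewrite /Et /tgen E_sref ?pact0 //; congr (E _ * _); apply: WtE => //=.
by apply/ffunP => k; rewrite !ffunE tpermV -(inj_eq (@perm_inj _ (sref i)) _ j) tpermK.
Qed.

Lemma Et_comm j k : Et j * Et k = Et k * Et j.
Proof. exact: E_prm1_comm. Qed.

Lemma Et_order j : Et j ^+ d = 1.
Proof.
rewrite -E_tgenX -E_one; congr (E _).
rewrite tgenX; apply: WtE => //=; apply/ffunP => k; rewrite ffunMnE !ffunE Zp_mulrn.
by apply: val_inj; rewrite /= modnMl.
Qed.

Lemma EX_EXinv j : EX j * EXinv j = 1 /\ EXinv j * EX j = 1.
Proof.
rewrite /EX /EXinv !(B_prod HE) // -E_one; split; congr (E _); apply: WtE;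
  by rewrite /= ?pact1 ?addr0 ?subrr ?addNr // /pcomp mulg1.
Qed.

Lemma EX_comm j k : EX j * EX k = EX k * EX j.
Proof. exact: E_prm1_comm. Qed.

Lemma EX_Eg_comm i j : j != posl i -> j != posr i -> EX j * Eg i = Eg i * EX j.
Proof.
move=> jl jr; rewrite /EX [LHS](_ : _ = E (MkWt (pact (sref i) 0) (delta j) 1%g) * Eg i).
  rewrite E_sref //; apply/ffunP => k; rewrite !ffunE.
  rewrite -(inj_eq (@perm_inj _ (sref i)) _ j) permKV /sref tpermD // eq_sym //.
by rewrite pact0.
Qed.

(** Let c be (q - q^-1) times the idempotent attached to s_i. The Bernstein relation reads
E(delta_(i+1)) E(s_i) - E(s_i) E(delta_i) = c E(delta_(i+1)). Multiply it on the right
by E(s_i) and expand E(s_i)^2 = 1 + c E(s_i): the terms in c cancel, as c commutes with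
E(delta_(i+1)). *)
Lemma Eg_EX_Eg i : Eg i * EX (posl i) * Eg i = EX (posr i).
Proof.
have := B_rel HE 0 0 i (delta (posl i)).
rewrite /= Wtor0_mul conj_sref cparE.
have sd : pact (sref i) (delta (posl i)) = delta (posr i).
  apply/ffunP => k; rewrite !ffunE tpermV.
  by rewrite -(inj_eq (@perm_inj _ (sref i)) _ (posl i)) tpermK sref_posl.
have dotE : dotZ (varepsilon i) (delta (posl i)) = 1.
  rewrite /dotZ (bigD1 (posl i)) //= !ffunE eqxx (negPf (posl_neq i)) big1 //.
  by move=> k kl; rewrite [delta _ _]ffunE (negPf kl) mulr0.
rewrite pact0 sd ifF; last first.
  apply/negbTE/eqP => /ffunP/(_ (posl i)); rewrite !ffunE eqxx.
  by rewrite (negPf (posl_neq i)).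
rewrite /mu /eps_sign dotE /= sgr1 /= big_nat1 mulr0n addr0 scale1r sd.
rewrite Wtor0 !mul1g -/(Eg i) -/(EX (posl i)) -/(EX (posr i)).
set c := idem _ _ _ => /eqP; rewrite subr_eq addrC -subr_eq => /eqP <-.
have cx : c * EX (posr i) = EX (posr i) * c.
  by apply/esym/idem_commr; apply: E_prm1_comm.
have := Eg_quad i; rewrite -/c; move: (c) cx => c' cx' eq2.
by rewrite mulrBl -mulrA -expr2 eq2 mulrDr mulr1 -scalerAr -!scalerAl cx' mulrA addrK.
Qed.

End Images.

(** * The homomorphism from the affine Yokonuma--Hecke algebra *)

Section Hom.
Variables (K : realType) (b : qparam K) (d' n' : nat).
Local Notation d := d'.+1.
Local Notation n := n'.+1.
Local Notation R := (base b).
Local Notation q := (qof b).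
Local Notation W := (Wt d' n').
Variables (H : algType R) (T E : W -> H).
Hypothesis HE : is_Bernstein T E.
Implicit Types (i : 'I_n') (j k : 'I_n) (a : {ffun 'I_n -> 'I_d}).
Local Notation Y := (Yaff b d' n').

Definition Ygen_image (x : Ygens n') : H :=
  match x with
  | Gen_t j => Et E j
  | Gen_g i => Eg E i
  | Gen_X => EX E ord0
  | Gen_Xinv => EXinv E ord0
  end.

Local Notation ev := (eval_free Ygen_image).

Lemma eval_Y_exp x m : ev (x ^+ m) = ev x ^+ m.
Proof.
by elim: m => [|m IHm]; rewrite ?expr0 ?eval_free1 // !exprS [LHS]eval_freeM IHm.
Qed.

Lemma eval_Y_idem x y : ev (idem d' x y) = idem d' (ev x) (ev y).
Proof.
rewrite /idem [LHS]eval_freeZ; congr (_ *: _).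
rewrite (big_morph ev (eval_freeD _) (eval_free0 _)).
by apply: eq_bigr => k _; rewrite [LHS]eval_freeM !eval_Y_exp.
Qed.

Lemma Ygen_image_rels x y : @Yrel K b d' n' x y -> ev x = ev y.
Proof.
case=> [i j /orP ij|i j ij|i j|i j|j|||i i0|i i0|j|i].
- rewrite [LHS]eval_freeM [RHS]eval_freeM !eval_free_gen.
  by case: ij => ij; [|apply/esym]; apply: (Eg_comm HE ij).
- rewrite [LHS]eval_freeM [RHS]eval_freeM [in LHS]eval_freeM [in RHS]eval_freeM.
  by rewrite !eval_free_gen /= (Eg_braid HE ij).
- by rewrite [LHS]eval_freeM [RHS]eval_freeM !eval_free_gen /= (Et_comm HE).
- by rewrite [LHS]eval_freeM [RHS]eval_freeM !eval_free_gen /= (Eg_Et HE).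
- by rewrite eval_Y_exp eval_free1 eval_free_gen /= (Et_order HE).
- by rewrite [LHS]eval_freeM eval_free1 !eval_free_gen /= (EX_EXinv HE _).1.
- by rewrite [LHS]eval_freeM eval_free1 !eval_free_gen /= (EX_EXinv HE _).2.
(* g_1 X_1 g_1 is sent to E(delta_2), which commutes with E(delta_1). *)
- rewrite [LHS]eval_freeM [RHS]eval_freeM [in LHS]eval_freeM [in RHS]eval_freeM.
  rewrite [in LHS]eval_freeM [in RHS]eval_freeM !eval_free_gen /=.
  have -> : ord0 = posl i by apply: val_inj; rewrite /= i0.
  by rewrite (Eg_EX_Eg HE) -mulrA -mulrA [Eg E i * _]mulrA (Eg_EX_Eg HE) (EX_comm HE).
- rewrite [LHS]eval_freeM [RHS]eval_freeM !eval_free_gen /= (EX_Eg_comm HE) //.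
    by apply/eqP => /(congr1 val) /= e; rewrite -e in i0.
- by rewrite [LHS]eval_freeM [RHS]eval_freeM !eval_free_gen /=; apply: E_prm1_comm HE _ _ _ _.
- rewrite eval_Y_exp [RHS]eval_freeD eval_free1 [in RHS]eval_freeZ [in RHS]eval_freeM.
  by rewrite eval_Y_idem !eval_free_gen (Eg_quad HE).
Qed.

Definition Yhom : Y -> H := eval_pres Ygen_image (rels := @Yrel K b d' n').

Lemma YhomD : {morph Yhom : x y / x + y}.
Proof. exact: eval_presD Ygen_image_rels. Qed.
Lemma YhomM : {morph Yhom : x y / x * y}.
Proof. exact: eval_presM Ygen_image_rels. Qed.
Lemma YhomZ c : {morph Yhom : x / c *: x}.
Proof. exact: eval_presZ Ygen_image_rels c. Qed.
Lemma Yhom1 : Yhom 1 = 1.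
Proof. exact: eval_pres1 Ygen_image_rels. Qed.

Lemma Yhom_linear : linear Yhom.
Proof. by move=> c x y; rewrite YhomD YhomZ. Qed.

Definition Yhom_lin : {linear Y -> H} :=
  HB.pack Yhom (GRing.isLinear.Build R Y H *:%R Yhom Yhom_linear).

End Hom.

(** * A spanning family of the affine Yokonuma--Hecke algebra *)

Section RingIdentities.
Variable A : pzRingType.
Implicit Types g h x t s : A.

(** For g = g_i, h = g_(i+1) and x = X_i: the commutation of g_i with X_(i+2). *)
Lemma braid_sandwich_comm g h x : g * h * g = h * g * h -> GRing.comm h x ->
  GRing.comm g (h * (g * x * g) * h).
Proof.
move=> br hx; rewrite /GRing.comm !mulrA br -(mulrA _ h x) hx.
by rewrite -!(mulrA _ h) -!(mulrA _ g) !(mulrA h) !(mulrA g) br !mulrA.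
Qed.

(** For x = X_i and g = g_i, this propagates the commutation with the t_j to X_(i+1). *)
Lemma swap_sandwich_comm g x t s : t * g = g * s -> s * g = g * t ->
  GRing.comm s x -> GRing.comm t (g * x * g).
Proof.
move=> tg sg sx; rewrite /GRing.comm !mulrA tg -(mulrA g s) sx.
by rewrite -!mulrA sg.
Qed.

End RingIdentities.

Section Spanning.
Variables (K : realType) (b : qparam K) (d' n' : nat).
Local Notation d := d'.+1.
Local Notation n := n'.+1.
Local Notation R := (base b).
Local Notation Y := (Yaff b d' n').
Local Notation rels := (@Yrel K b d' n').
Implicit Types (i : 'I_n') (j k : 'I_n) (a : {ffun 'I_n -> 'I_d}).
Local Notation t := (@Yt K b d' n').
Local Notation g := (@Yg K b d' n').
Local Notation X := (@YX K b d' n').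
Local Notation XN := (@YX_nat K b d' n').
Local Notation cl := (@pres_class _ _ rels : _ -> Y).
Local Notation c := (qof b - (qof b)^-1).
Local Notation gen x := (free_gen R (x : Ygens n')).

Definition Ye i : Y := idem d' (t (posl i)) (t (posr i)).

Lemma clX x m : cl (x ^+ m) = cl x ^+ m.
Proof.
elim: m => [|m IHm]; first by rewrite !expr0; exact: pres_class1.
by rewrite !exprS -IHm; exact: pres_classM.
Qed.

Lemma clM x y : cl (x * y) = cl x * cl y.
Proof. exact: pres_classM. Qed.

Lemma cl_e i : cl (idem d' (gen (Gen_t (posl i))) (gen (Gen_t (posr i)))) = Ye i.
Proof.
rewrite /idem [LHS]pres_classZ /Ye /idem; congr (_ *: _).
rewrite (big_morph cl (@pres_classD _ _ rels) (@pres_class0 _ _ rels)).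
by apply: eq_bigr => k _; rewrite [LHS]clM !clX.
Qed.

Lemma Yg_comm i i' : (i.+1 < i')%N -> g i * g i' = g i' * g i.
Proof.
move=> ii'; have := pres_class_rel (@Yrel_gg K b d' n' i i' (introT orP (or_introl ii'))).
by rewrite [LHS]clM [RHS]clM.
Qed.

Lemma Yg_braid i i' : i' = i.+1 :> nat -> g i * g i' * g i = g i' * g i * g i'.
Proof.
move=> ii'; have := pres_class_rel (@Yrel_braid K b d' n' i i' ii').
by rewrite [LHS]clM [RHS]clM [in LHS]clM [in RHS]clM.
Qed.

Lemma Yt_comm j k : t j * t k = t k * t j.
Proof.
have := pres_class_rel (@Yrel_tt K b d' n' j k).
by rewrite [LHS]clM [RHS]clM.
Qed.

Lemma Yg_Yt i j : g i * t j = t (sref i j) * g i.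
Proof.
have := pres_class_rel (@Yrel_gt K b d' n' i j).
by rewrite [LHS]clM [RHS]clM.
Qed.

Lemma Yt_order j : t j ^+ d = 1.
Proof.
have := pres_class_rel (@Yrel_td K b d' n' j).
by rewrite [LHS]clX => ->; exact: pres_class1.
Qed.

Lemma YX1V : YX1 b d' n' * cl (gen (Gen_Xinv n')) = 1.
Proof.
have := pres_class_rel (@Yrel_XV K b d' n').
by rewrite [LHS]clM => ->; exact: pres_class1.
Qed.

Lemma YVX1 : cl (gen (Gen_Xinv n')) * YX1 b d' n' = 1.
Proof.
have := pres_class_rel (@Yrel_VX K b d' n').
by rewrite [LHS]clM => ->; exact: pres_class1.
Qed.

Lemma YX1gX1g i : i = 0 :> nat ->
  XN 0 * g i * XN 0 * g i = g i * XN 0 * g i * XN 0.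
Proof.
move=> i0; have := pres_class_rel (@Yrel_XgXg K b d' n' i i0).
by rewrite [LHS]clM [RHS]clM [in LHS]clM [in RHS]clM [in LHS]clM [in RHS]clM.
Qed.

Lemma YX1g i : (0 < i)%N -> XN 0 * g i = g i * XN 0.
Proof.
move=> i0; have := pres_class_rel (@Yrel_Xg K b d' n' i i0).
by rewrite [LHS]clM [RHS]clM.
Qed.

Lemma YX1t j : XN 0 * t j = t j * XN 0.
Proof.
have := pres_class_rel (@Yrel_Xt K b d' n' j).
by rewrite [LHS]clM [RHS]clM.
Qed.

Lemma Yg_quad i : g i * g i = 1 + c *: (Ye i * g i).
Proof.
have := pres_class_rel (@Yrel_quad K b d' n' i).
rewrite [LHS]clX => e; rewrite -expr2 [LHS]e [LHS]pres_classD.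
rewrite [pres_class _ 1]pres_class1; congr (_ + _).
by rewrite [LHS]pres_classZ [in LHS]clM cl_e.
Qed.

Lemma Yg_Ye i : g i * Ye i = Ye i * g i.
Proof.
apply: idem_commute; [exact: Yt_comm|exact: Yt_order|exact: Yt_order| |].
  by rewrite Yg_Yt sref_posl.
by rewrite Yg_Yt sref_posr.
Qed.

Lemma Yg_inverse i : g i * (g i - c *: Ye i) = 1 /\ (g i - c *: Ye i) * g i = 1.
Proof.
by rewrite mulrBl mulrBr -scalerAr -scalerAl Yg_Ye Yg_quad addrK.
Qed.

Lemma Yg_unit i : g i \is a GRing.unit.
Proof. by apply/unitrP; exists (g i - c *: Ye i); have [] := Yg_inverse i. Qed.

Lemma Yg_nat_unit m : oapp g 1 (insub m) \is a GRing.unit.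
Proof. by case: insub => [i|] /=; [exact: Yg_unit|exact: unitr1]. Qed.

Lemma YX_nat_unit m : XN m \is a GRing.unit.
Proof.
elim: m => [|m IHm] /=; last by rewrite !unitrMl ?Yg_nat_unit.
by apply/unitrP; exists (cl (gen (Gen_Xinv n'))); split; [exact: YVX1|exact: YX1V].
Qed.

Lemma YX_natS i : XN i.+1 = g i * XN i * g i.
Proof. by rewrite /= valK. Qed.

Lemma Yg_nat_comm i m : (m.+1 < i)%N || (i.+1 < m)%N ->
  GRing.comm (g i) (oapp g 1 (insub m)).
Proof.
case: insubP => [i' _ <- /orP[h|h]|_ _] /=; last exact: commr1.
  exact: esym (Yg_comm h).
exact: Yg_comm h.
Qed.

Lemma Yg_YX_nat_lt i m : (m < i)%N -> GRing.comm (g i) (XN m).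
Proof.
elim: m => [|m IHm] lt; first exact: esym (YX1g lt).
have gc := @Yg_nat_comm i m (introT orP (or_introl lt)).
by apply: (commrM (commrM gc _) gc); apply: IHm; apply: ltnW.
Qed.

Lemma Yg_YX_nat_gt i m : (i.+1 < m)%N -> (m <= n')%N -> GRing.comm (g i) (XN m).
Proof.
elim: m => // m IHm; rewrite ltnS leq_eqVlt => /orP[/eqP <- lt|lt ltm]; last first.
  have gc := @Yg_nat_comm i m (introT orP (or_intror lt)).
  by apply: (commrM (commrM gc _) gc); apply: IHm => //; apply: ltnW.
have [i' ii'] : exists i' : 'I_n', i.+1 = i' by exists (Ordinal lt).
have br := Yg_braid (esym ii'); have cX : g i' * XN i = XN i * g i'.
  by apply: Yg_YX_nat_lt; rewrite -ii'.
by rewrite ii' YX_natS -ii' YX_natS; apply: braid_sandwich_comm.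
Qed.

(** Induction on the larger index, through X_(m'+1) = g_m' X_m' g_m'. When m < m',
X_m commutes with both factors. When m = m', X_m is in turn a product of g_(m-1) and
X_(m-1), which commute with X_(m+1); the case m = 0 is the defining relation between
X_1 and g_1. *)
Lemma YX_nat_comm m m' : (m < m')%N -> (m' <= n')%N -> GRing.comm (XN m) (XN m').
Proof.
elim: m' m => // m' IHm' m; rewrite ltnS leq_eqVlt => /orP[/eqP ->|lt] ltm.
  case: m' ltm IHm' => [|m'] ltm IHm'.
    by rewrite /GRing.comm (YX_natS (Ordinal ltm)) !mulrA YX1gX1g.
  have lt' : (m' < n')%N by apply: ltnW.
  have gX : GRing.comm (g (Ordinal lt')) (XN m'.+2) by apply: Yg_YX_nat_gt.
  apply: commr_sym; rewrite (YX_natS (Ordinal lt')).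
  apply: commrM; first apply: commrM; try exact: commr_sym gX.
  apply: commr_sym; rewrite (YX_natS (Ordinal ltm)).
  by apply: commrM; [apply: commrM|]; try (by apply: commr_sym; apply: Yg_YX_nat_lt);
    apply: IHm' => //; apply: ltnW.
rewrite (YX_natS (Ordinal ltm)).
apply: commrM; first apply: commrM; try (by apply: commr_sym; apply: Yg_YX_nat_lt).
by apply: IHm' => //; apply: ltnW.
Qed.

Lemma YX_comm j k : GRing.comm (X j) (X k).
Proof.
have := ltn_ord k; have := ltn_ord j; rewrite !ltnS => jn kn.
have [jk|kj|/val_inj ->] := ltngtP j k; last exact: commr_refl.
  exact: YX_nat_comm.
by apply: commr_sym; apply: YX_nat_comm.
Qed.

Lemma Yt_YX_nat m j : (m <= n')%N -> GRing.comm (t j) (XN m).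
Proof.
elim: m j => [|m IHm] j lt; first exact: esym (YX1t j).
rewrite (YX_natS (Ordinal lt)); set i := Ordinal lt.
have tg k : t k * g i = g i * t (sref i k) by rewrite Yg_Yt tpermK.
apply: (swap_sandwich_comm (tg j)); last exact: IHm (ltnW lt).
by rewrite tg tpermK.
Qed.

Lemma Yt_YX j k : GRing.comm (t j) (X k).
Proof. by apply: Yt_YX_nat; rewrite -ltnS. Qed.

Lemma YX_unit j : X j \is a GRing.unit.
Proof. exact: YX_nat_unit. Qed.

Lemma YX_posr i : X (posr i) = g i * X (posl i) * g i.
Proof. exact: YX_natS. Qed.

Lemma YXV_posl i : (X (posl i))^-1 = g i * (X (posr i))^-1 * g i.
Proof.
have gu := Yg_unit i.
by rewrite YX_posr !invrM ?unitrMl ?YX_unit // !mulrA mulrV // mul1r mulrVK.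
Qed.

Lemma Yg_YX_comm i j : j != posl i -> j != posr i -> GRing.comm (g i) (X j).
Proof.
move=> jl jr; have [lt|gt|e] := ltngtP j i.
- exact: Yg_YX_nat_lt.
- apply: Yg_YX_nat_gt; last by rewrite -ltnS.
  rewrite ltn_neqAle gt andbT; apply: contra jr => /eqP e.
  by apply/eqP/val_inj; rewrite /= -e.
- by case/eqP: jl; apply: val_inj.
Qed.

(** The subalgebra generated by the t_j and the X_j, inverses included, given by left
multiplications so that induction peels off one generator at a time. *)
Inductive TX : Y -> Prop :=
  | TX1 : TX 1
  | TXD x y of TX x & TX y : TX (x + y)
  | TXZ (r : R) x of TX x : TX (r *: x)
  | TXt j x of TX x : TX (t j * x)
  | TXx j x of TX x : TX (X j * x)
  | TXv j x of TX x : TX ((X j)^-1 * x).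

Lemma TX0 : TX 0.
Proof. by rewrite -(scale0r (1 : Y)); apply: TXZ; apply: TX1. Qed.

Lemma TXM x y : TX x -> TX y -> TX (x * y).
Proof.
move=> + Ty; elim=> [|u v _ Tu _ Tv|r u _ Tu|j u _ Tu|j u _ Tu|j u _ Tu].
- by rewrite mul1r.
- by rewrite mulrDl; apply: TXD.
- by rewrite -scalerAl; apply: TXZ.
- by rewrite -mulrA; apply: TXt.
- by rewrite -mulrA; apply: TXx.
- by rewrite -mulrA; apply: TXv.
Qed.

Lemma TX_e i : TX (Ye i).
Proof.
have Tt j m : TX (t j ^+ m).
  by elim: m => [|m IHm]; [exact: TX1|rewrite exprS; apply: TXt].
apply: TXZ; apply: (big_ind TX); first exact: TX0.
  exact: TXD.
by move=> m _; apply: TXM.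
Qed.

(** From y = g x g: g x = y g^-1 with g^-1 = g - (q - q^-1) e, and
g y = g^2 x g = x g + (q - q^-1) e y. It applies to X_i and X_(i+1), and in the
opposite order to their inverses. *)
Lemma g_sandwich i x y : TX x -> TX y -> y = g i * x * g i ->
  (exists x' r, [/\ TX x', TX r & g i * x = x' * g i + r]) /\
  (exists y' r, [/\ TX y', TX r & g i * y = y' * g i + r]).
Proof.
move=> Tx Ty yE; split.
  exists y, (- c *: (y * Ye i)); split=> //.
    by apply: TXZ; apply: TXM => //; apply: TX_e.
  have [gV _] := Yg_inverse i; have e : y * (g i - c *: Ye i) = g i * x.
    by rewrite yE -mulrA gV mulr1.
  by rewrite -e mulrBr -scalerAr scaleNr.
exists x, (c *: (Ye i * y)); split=> //.
  by apply: TXZ; apply: TXM => //; apply: TX_e.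
rewrite {1}yE !mulrA Yg_quad !mulrDl mul1r -!scalerAl.
by congr (_ + _ *: _); rewrite yE !mulrA.
Qed.

(** The elements x with this property are closed under products, because TX is. *)
Lemma g_TX i x : TX x -> exists x' r, [/\ TX x', TX r & g i * x = x' * g i + r].
Proof.
have comm_case y : TX y -> GRing.comm (g i) y ->
    exists x' r, [/\ TX x', TX r & g i * y = x' * g i + r].
  by move=> Ty gy; exists y, 0; split=> //; [exact: TX0|rewrite addr0; exact: gy].
have step u v : TX u -> (exists x' r, [/\ TX x', TX r & g i * u = x' * g i + r]) ->
    TX v -> (exists x' r, [/\ TX x', TX r & g i * v = x' * g i + r]) ->
    exists x' r, [/\ TX x', TX r & g i * (u * v) = x' * g i + r].
  move=> Tu [u' [r [Tu' Tr ue]]] Tv [v' [s [Tv' Ts ve]]].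
  exists (u' * v'), (u' * s + r * v); split; first exact: TXM.
    by apply: TXD; apply: TXM.
  by rewrite mulrA ue mulrDl -mulrA ve mulrDr !mulrA addrA.
have genx j : TX (X j) by rewrite -[X j]mulr1; apply: TXx; apply: TX1.
have genv j : TX (X j)^-1 by rewrite -[(X j)^-1]mulr1; apply: TXv; apply: TX1.
have gent j : TX (t j) by rewrite -[t j]mulr1; apply: TXt; apply: TX1.
have [xl xr] := g_sandwich (genx _) (genx _) (YX_posr i).
have [vr vl] := g_sandwich (genv _) (genv _) (YXV_posl i).
elim=> [|u v _ Tu _ Tv|r u _ Tu|j u Tu gu|j u Tu gu|j u Tu gu].
- by apply: comm_case; [exact: TX1|exact: commr1].
- case: Tu => u' [r [Tu' Tr ue]]; case: Tv => v' [s [Tv' Ts ve]].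
  exists (u' + v'), (r + s); split; try exact: TXD.
  by rewrite mulrDr ue ve mulrDl addrACA.
- case: Tu => u' [s [Tu' Ts ue]]; exists (r *: u'), (r *: s).
  by split; try exact: TXZ; rewrite -scalerAr ue scalerDr scalerAl.
- apply: step => //; exists (t (sref i j)), 0; rewrite addr0 Yg_Yt.
  by split=> //; apply: TX0.
- apply: step => //; have [->//|jl] := eqVneq j (posl i).
  have [->//|jr] := eqVneq j (posr i).
  by apply: comm_case => //; apply: Yg_YX_comm.
- apply: step => //; have [->//|jl] := eqVneq j (posl i).
  have [->//|jr] := eqVneq j (posr i).
  by apply: comm_case => //; apply: commrV; apply: Yg_YX_comm.
Qed.

Definition Ymon (p : {ffun 'I_n -> 'I_d} * {ffun 'I_n -> int}) : Y :=
  (\prod_j t j ^+ p.1 j) * (\prod_j X j ^ p.2 j).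

Lemma prod_comm (r : seq 'I_n) (F G : 'I_n -> Y) :
  (forall j k, GRing.comm (F j) (G k)) ->
  \prod_(j <- r) F j * \prod_(j <- r) G j = \prod_(j <- r) (F j * G j).
Proof.
move=> FG; elim: r => [|j r IHr]; first by rewrite !big_nil mulr1.
rewrite !big_cons -IHr -!mulrA; congr (_ * _); rewrite !mulrA; congr (_ * _).
by apply/commr_sym/commr_prod => k _; apply: commr_sym.
Qed.

Lemma prod_pred1 (F : 'I_n -> Y) j : F j = \prod_k (if k == j then F k else 1).
Proof. by rewrite -big_mkcond big_pred1_eq. Qed.

Lemma commrXz (x y : Y) (m : int) : GRing.comm x y -> GRing.comm x (y ^ m).
Proof.
by case: m => m xy; [exact: commrX|apply: commrV; exact: commrX].
Qed.

Lemma t_Ymon j p : exists p', t j * Ymon p = Ymon p'.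
Proof.
exists ([ffun k => inZp (k == j)] + p.1, p.2); rewrite /Ymon mulrA /=.
congr (_ * _); rewrite [t j]prod_pred1 prod_comm => [|k l]; last first.
  by case: ifP => _; [apply: commrX; exact: Yt_comm|apply: commr_sym; exact: commr1].
apply: eq_bigr => k _; rewrite !ffunE /= !(expr_mod _ (Yt_order k)) exprD.
by rewrite !(expr_mod _ (Yt_order k)); case: (k == j).
Qed.

Lemma X_Ymon j p (m : int) : exists p', X j ^ m * Ymon p = Ymon p'.
Proof.
exists (p.1, [ffun k => m * (k == j)%:R] + p.2); rewrite /Ymon /=.
(* The power of X_j is first moved across the t_k. *)
have -> : X j ^ m * (\prod_j t j ^+ p.1 j * \prod_j X j ^ p.2 j) =
    \prod_j t j ^+ p.1 j * (X j ^ m * \prod_j X j ^ p.2 j).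
  rewrite !mulrA; congr (_ * _); apply: commr_prod => k _.
  by apply/commr_sym/commrXz/commr_sym/commrX/commr_sym/Yt_YX.
congr (_ * _); rewrite [X j ^ m](prod_pred1 (fun k => X k ^ m)) prod_comm => [|k l].
  apply: eq_bigr => k _; rewrite !ffunE exprzDr ?YX_unit //.
  by case: (k == j); rewrite ?mulr1 ?mulr0.
case: ifP => _; last by apply: commr_sym; exact: commr1.
by apply: commrXz; apply: commr_sym; apply: commrXz; exact: YX_comm.
Qed.

Lemma TX_span x : TX x -> in_span Ymon x.
Proof.
have mulspan (u : Y) : (forall p, exists p', u * Ymon p = Ymon p') ->
    forall y, in_span Ymon y -> in_span Ymon (u * y).
  move=> up y; apply: (in_span_ind (P := fun y => in_span Ymon (u * y))).
  - by rewrite mulr0; apply: in_span0.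
  - by move=> v w Sv Sw; rewrite mulrDr; apply: in_spanD.
  move=> r p; rewrite -scalerAr; apply: in_spanZ.
  by have [p' ->] := up p; apply: in_span_gen.
elim=> [|u v _ Su _ Sv|r u _ Su|j u _ Su|j u _ Su|j u _ Su].
- have -> : (1 : Y) = Ymon (0, 0).
    by rewrite /Ymon !big1 ?mulr1 // => j _; rewrite ffunE.
  exact: in_span_gen.
- exact: in_spanD.
- exact: in_spanZ.
- by apply: mulspan => // p; apply: t_Ymon.
- by apply: mulspan => // p; have [p' e] := X_Ymon j p 1; exists p'; rewrite -e expr1z.
- by apply: mulspan => // p; have [p' e] := X_Ymon j p (-1); exists p'; rewrite -e.
Qed.

Lemma Yg_permE (s : seq 'I_n') : size s = inversions (word_perm s) ->
  Yg_perm b d' (word_perm s) = \prod_(i <- s) g i.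
Proof.
move=> sz; have [rw rz] := reduced_wordP (word_perm s).
exact: (matsumoto Yg_comm Yg_braid rw rz erefl sz).
Qed.

Lemma Yg_perm_up i (w : 'S_n) : ~~ ldesc i w ->
  g i * Yg_perm b d' w = Yg_perm b d' (pcomp (sref i) w).
Proof.
move=> nd; have [s sw sz] := ex_word w.
have wE : pcomp (sref i) w = word_perm (i :: s) by rewrite /= sw.
rewrite wE -[in LHS]sw !Yg_permE ?big_cons ?sw // -wE inversions_up //.
by rewrite /= sz.
Qed.

Lemma Yg_perm_down i (w : 'S_n) : ldesc i w ->
  g i * Yg_perm b d' w =
  Yg_perm b d' (pcomp (sref i) w) + c *: (Ye i * Yg_perm b d' w).
Proof.
move=> dw; have gw : g i * Yg_perm b d' (pcomp (sref i) w) = Yg_perm b d' w.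
  by rewrite Yg_perm_up ?pcomp_srefK // ldesc_sref negbK.
by rewrite -{1}gw mulrA Yg_quad mulrDl mul1r -scalerAl -mulrA gw.
Qed.

(** The family [Ybasis] indexed by a single eqType. *)
Definition Yfamily (p : {ffun 'I_n -> 'I_d} * {ffun 'I_n -> int} * 'S_n) : Y :=
  Ybasis b p.1.1 p.1.2 p.2.

Lemma TX_g_span x (w : 'S_n) : TX x -> in_span Yfamily (x * Yg_perm b d' w).
Proof.
move/TX_span; apply: (in_span_ind (P := fun x => in_span Yfamily (x * _))).
- by rewrite mul0r; apply: in_span0.
- by move=> u v Su Sv; rewrite mulrDl; apply: in_spanD.
move=> r p; rewrite -scalerAl; apply: in_spanZ.
exact: (in_span_gen Yfamily (p, w)).
Qed.

Lemma TX_Ymon p : TX (Ymon p).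
Proof.
apply: TXM; apply: (big_ind TX); try exact: TX1; try exact: TXM.
  by move=> j _; elim: (p.1 j : nat) => [|m IHm]; [exact: TX1|rewrite exprS; apply: TXt].
move=> j _; case: (p.2 j) => m.
  by elim: m => [|m IHm]; [exact: TX1|rewrite exprSz; apply: TXx].
rewrite NegzE -exprz_inv.
by elim: m.+1 => [|k IHk]; [exact: TX1|rewrite exprSz; apply: TXv].
Qed.

Lemma Yfamily_spans x : in_span Yfamily x.
Proof.
move: x; apply: (pres_ind (rels := rels)).
- have -> : 1 = Yfamily (0, 0, 1%g).
    rewrite /Yfamily /Ybasis !big1 => [|j _|j _]; rewrite ?ffunE //.
    have -> : Yg_perm b d' 1%g = \prod_(i <- [::]) g i.
      by apply: (@Yg_permE [::]); rewrite inversions1.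
    by rewrite big_nil !mulr1.
  exact: in_span_gen.
- by move=> x y; apply: in_spanD.
- by move=> r x; apply: in_spanZ.
move=> z x; pose u : Y := pres_gen rels z; rewrite -[_ * _]/(u * x).
apply: (in_span_ind (P := fun x => in_span Yfamily (u * x)))
  => [|v v' Sv Sv'|r [[a l] w]].
- by rewrite mulr0; apply: in_span0.
- by rewrite mulrDr; apply: in_spanD.
rewrite -scalerAr; apply: in_spanZ; rewrite /Yfamily /Ybasis /= -/(Ymon (a, l)).
have Tm := TX_Ymon (a, l); rewrite {}/u; case: z => [j|i||].
- by rewrite mulrA; apply: TX_g_span; apply: TXt.
- rewrite -[pres_gen _ _]/(g i) mulrA.
  have [x' [s [Tx' Ts ->]]] := g_TX i Tm.
  rewrite mulrDl; apply: in_spanD; last exact: TX_g_span.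
  rewrite -mulrA; case: (boolP (ldesc i w)) => [dw|nd]; last first.
    by rewrite Yg_perm_up //; apply: TX_g_span.
  rewrite Yg_perm_down // mulrDr; apply: in_spanD; first exact: TX_g_span.
  rewrite -scalerAr mulrA; apply: in_spanZ; apply: TX_g_span.
  by apply: TXM => //; apply: TX_e.
- by rewrite mulrA; apply: TX_g_span; apply: (TXx ord0).
- rewrite mulrA; apply: TX_g_span.
  have -> : pres_gen rels (Gen_Xinv n' : Ygens n') = (X ord0)^-1.
    apply: (mulrI (YX_unit ord0)); rewrite mulrV ?YX_unit //; exact: YX1V.
  exact: TXv.
Qed.

End Spanning.

(** * The homomorphism is an isomorphism *)

Section Final.
Variables (K : realType) (b : qparam K) (d' n' : nat).
Local Notation d := d'.+1.
Local Notation n := n'.+1.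
Local Notation R := (base b).
Local Notation W := (Wt d' n').
Variables (H : algType R) (T E : W -> H).
Hypothesis HE : is_Bernstein T E.
Implicit Types (i : 'I_n') (j k : 'I_n) (a : {ffun 'I_n -> 'I_d}).
Local Notation Y := (Yaff b d' n').
Local Notation phi := (Yhom_lin HE).

Lemma phiM : {morph phi : x y / x * y}. Proof. exact: (YhomM HE). Qed.
Lemma phi1 : phi 1 = 1. Proof. exact: (Yhom1 HE). Qed.
Lemma phi_gen x : phi (pres_gen (@Yrel K b d' n') x) = Ygen_image E x.
Proof. exact: eval_pres_gen (Ygen_image_rels HE) x. Qed.

Lemma phi_prod (I : Type) (r : seq I) (F : I -> Y) :
  phi (\prod_(x <- r) F x) = \prod_(x <- r) phi (F x).
Proof. exact: (big_morph _ phiM phi1). Qed.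

Lemma phiX x m : phi (x ^+ m) = phi x ^+ m.
Proof. by elim: m => [|m IHm]; rewrite ?expr0 ?phi1 // !exprS phiM IHm. Qed.

Lemma phi_Yg_perm (w : 'S_n) : phi (Yg_perm b d' w) = E (Wprm d' w).
Proof.
have [rw rz] := reduced_wordP w; rewrite phi_prod -[in RHS]rw -(E_word HE) ?rw //.
by apply: eq_bigr => i _; rewrite phi_gen.
Qed.

Lemma phi_YX j : phi (YX b d' j) = EX E j.
Proof.
case: j => m; elim: m => [|m IHm] lt.
  have -> : Ordinal lt = ord0 by apply: val_inj.
  exact: (phi_gen (Gen_X n')).
have lt' : (m < n')%N by [].
have <- : posr (Ordinal lt') = Ordinal lt by apply: ord_inj; rewrite posr_val.
have e : posl (Ordinal lt') = Ordinal (ltnW lt) by apply: ord_inj.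
by rewrite YX_posr !phiM !phi_gen -(Eg_EX_Eg HE) e IHm.
Qed.

Lemma E_prod_prm1 (I : Type) (r : seq I) (F : I -> W) :
  (forall x, prm (F x) = 1%g) ->
  \prod_(x <- r) E (F x) = E (\prod_(x <- r) F x)%g.
Proof.
move=> F1; elim: r => [|x r IHr]; first by rewrite !big_nil (E_one HE).
by rewrite !big_cons IHr (B_prod HE).
Qed.

(** For negative exponents, the image of an inverse is the inverse of the image;
it is identified by multiplying with E of the opposite vector. *)
Lemma phi_YX_exp j (m : int) : phi (YX b d' j ^ m) = E (Wlat d' (delta j *~ m)).
Proof.
have pos (k : nat) : phi (YX b d' j ^+ k) = E (Wlat d' (delta j *+ k)).
  elim: k => [|l IHl]; first by rewrite expr0 phi1 -(E_one HE).
  by rewrite exprS phiM IHl phi_YX (B_prod HE) // -WlatD -mulrS.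
case: m => k; first exact: pos.
have -> : delta j *~ Negz k = - (delta j *+ k.+1) by [].
have eV : E (Wlat d' (delta j *+ k.+1)) * E (Wlat d' (- (delta j *+ k.+1))) = 1.
  by rewrite (B_prod HE) // -WlatD subrr -(E_one HE).
rewrite -[LHS]mulr1 -eV -pos mulrA -phiM -[_ ^ _]/(_ ^- _) mulVr ?phi1 ?mul1r //.
by rewrite unitrX // YX_unit.
Qed.

Lemma phi_prod_Yt a : phi (\prod_j Yt b d' j ^+ a j) = E (Wtor a).
Proof.
rewrite phi_prod; under eq_bigr => j _ do rewrite phiX phi_gen /= -(E_tgenX HE).
rewrite E_prod_prm1 => [|j]; last exact: prm_tgenX.
congr (E _).
under eq_bigr => j _ do rewrite tgenX.
rewrite -(big_morph (@Wtor d' n') (@WtorD d' n') (erefl : Wtor 0 = 1%g)); congr Wtor.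
apply/ffunP => k; rewrite sum_ffunE (bigD1 k) //= ffunMnE ffunE eqxx Zp_mulrn.
rewrite big1 ?addr0 => [|j jk].
  by apply: val_inj; rewrite /= modnMml mul1n modn_small.
rewrite ffunMnE ffunE eq_sym (negPf jk) Zp_mulrn; apply: val_inj => /=.
by rewrite !mod0n.
Qed.

Lemma phi_prod_YX (l : {ffun 'I_n -> int}) :
  phi (\prod_j YX b d' j ^ l j) = E (Wlat d' l).
Proof.
rewrite phi_prod; under eq_bigr => j _ do rewrite phi_YX_exp.
rewrite E_prod_prm1 //; congr (E _).
rewrite -(big_morph (@Wlat d' n') (@WlatD d' n') (erefl : Wlat d' 0 = 1%g)); congr Wlat.
apply/ffunP => k; rewrite sum_ffunE (bigD1 k) //= big1 ?addr0 => [|j jk].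
  by rewrite ffunMzE ffunE eqxx intz.
by rewrite ffunMzE ffunE eq_sym (negPf jk) mul0rz.
Qed.

Lemma phi_basis a l w : phi (Ybasis b a l w) = E (MkWt a l w).
Proof.
rewrite !phiM phi_prod_Yt phi_prod_YX phi_Yg_perm !(B_prod HE) //; last first.
  by rewrite /= /pcomp mulg1.
congr (E _); apply: WtE; rewrite /= ?pact1 ?pact0 ?addr0 ?add0r //.
by rewrite /pcomp !mulg1.
Qed.

Lemma phi_Yfamily_basis : is_basis (phi \o @Yfamily K b d' n').
Proof.
have [sp fr] := B_basis HE.
have phiE p : (phi \o @Yfamily K b d' n') p = E (tuple_Wt p) by exact: phi_basis.
split=> [x|s c us].
  have [s [c ->]] := sp x.
  exists [seq Wt_tuple w | w <- s], (fun p => c (tuple_Wt p)).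
  by rewrite big_map; apply: eq_bigr => w _; rewrite phiE Wt_tupleK.
under eq_bigr => p _ do rewrite phiE.
have tK : cancel (@tuple_Wt d' n') (@Wt_tuple d' n') by case=> [[]].
move=> sum0 p ps; have := fr [seq tuple_Wt p | p <- s] (fun w => c (Wt_tuple w)).
rewrite (map_inj_uniq (can_inj tK)) big_map => /(_ us).
under eq_bigr => i _ do rewrite tK.
by move=> /(_ sum0 (tuple_Wt p)); rewrite tK; apply; apply: map_f.
Qed.

Lemma phi_inj : injective phi.
Proof.
move=> x y xy; apply/eqP; rewrite -subr_eq0; apply/eqP.
apply: (in_span_free_inj phi_Yfamily_basis (Yfamily_spans _)).
by rewrite [LHS]linearB xy subrr.
Qed.

Lemma phi_surj (z : H) : exists x, phi x = z.
Proof.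
have [sp _] := phi_Yfamily_basis; have [s [c ->]] := sp z.
exists (\sum_(p <- s) c p *: Yfamily b p).
by rewrite linear_sum; apply: eq_bigr => p _; rewrite linearZ.
Qed.

Lemma phi_bij : bijective phi.
Proof.
pose psi z := xget 0 [set x | phi x = z]%classic.
have psiK z : phi (psi z) = z by exact: (xgetPex 0 (phi_surj z)).
by exists psi => // x; apply: phi_inj; rewrite psiK.
Qed.

End Final.

Theorem theorem4p1 (K : realType) (b : qparam K) (d' n' : nat)
    (H : algType (base b)) (T E : Wt d' n' -> H)
    (HT : is_Iwahori_Matsumoto T) (HE : is_Bernstein T E) :
  exists phi : {linear Yaff b d' n' -> H},
    [/\ forall (a : {ffun 'I_n'.+1 -> 'I_d'.+1}) (l : {ffun 'I_n'.+1 -> int})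
          (w : 'S_n'.+1), phi (Ybasis b a l w) = E (MkWt a l w),
        forall psi : {linear Yaff b d' n' -> H},
          (forall (a : {ffun 'I_n'.+1 -> 'I_d'.+1})
             (l : {ffun 'I_n'.+1 -> int}) (w : 'S_n'.+1),
             psi (Ybasis b a l w) = E (MkWt a l w)) -> psi =1 phi,
        GRing.monoid_morphism phi
      & bijective phi].
Proof.
exists (Yhom_lin HE); split.
- exact: phi_basis.
- move=> psi psiE x; move: (Yfamily_spans x).
  apply: (in_span_ind (P := fun x => psi x = Yhom_lin HE x)).
  + by rewrite !linear0.
  + by move=> u v eu ev; rewrite [LHS]linearD [RHS]linearD eu ev.
  + by move=> c [[a l] w]; rewrite [LHS]linearZ [RHS]linearZ psiE (phi_basis HE).
- by split; [exact: phi1|exact: phiM].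
- exact: phi_bij.
Qed.
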